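(* Let $\lambda,\mu>0$ and $\mathcal{K},\mathcal{S}>0$ be given. A unique single static, self-gravitating elastic shell $(\rho,p_{\mathrm{rad}},p_{\mathrm{tan}})$ in the Seth model with Lamé coefficients $\lambda,\mu$, with reference parameters $\mathcal{K},\mathcal{S}$ and with inner radius $r_0>0$ exists if and only if \[ r_{\mathrm{min}}:=\left(\frac{2\lambda}{3\lambda+2\mu}\right)^{1/2}\mathcal{S}\leq r_0<\mathcal{S}. \] Moreover $\rho(r_0)=0$ if and only if $r_0=r_{\mathrm{min}}$, while the outer radius $r_1$ of the shell satisfies $\rho(r_1)>0$ and \[ \sqrt{\frac{2\lambda}{3\lambda+2\mu}}\left(\mathcal{S}^3+\frac{3M}{4\pi\mathcal{K}}\right)^{1/3}<r_1<\left(\mathcal{S}^3+\frac{3M}{4\pi\mathcal{K}}\right)^{1/3}, \] where $M$ is the total mass of the shell.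
   Context: A single static, self-gravitating shell (spherically symmetric, with vacuum core) with inner radius $r_0>0$ and outer radius $r_1>r_0$ is a triple $(\rho,p_{\mathrm{rad}},p_{\mathrm{tan}})$ of real functions of $r\ge0$, $\rho\ge 0$, such that: - $\Omega:=\mathrm{Int}\{r>0:\rho(r)>0\}=(r_0,r_1)$; - $(\rho,p_{\mathrm{rad}},p_{\mathrm{tan}})\in C^1(\Omega)\cap C^0(\overline{\Omega})$ (continuity on $\overline\Omega=[r_0,r_1]$ of the restrictions to $\overline\Omega$) and in $\Omega$ \[ p_{\mathrm{rad}}'(r)+\frac{2}{r}\big(p_{\mathrm{rad}}(r)-p_{\mathrm{tan}}(r)\big)+\rho(r)\frac{m(r)}{r^2}=0,\qquad m(r)=4\pi\int_{r_0}^r\rho(s)s^2\,ds; \] - $p_{\mathrm{rad}},p_{\mathrm{tan}}>0$ in $\Omega$; - $p_{\mathrm{rad}}(r_0)=p_{\mathrm{rad}}(r_1)=0$; - $\rho=p_{\mathrm{rad}}=p_{\mathrm{tan}}=0$ on $[0,\infty)\setminus\overline\Omega$. The total mass is $M=m(r_1)$. The shell is made of Seth elastic matter with Lamé coefficients $\lambda,\mu>0$ and has reference parameters $\mathcal{K}>0$ (reference density) and $\mathcal{S}>0$ (reference inner radius) if for $r\in(r_0,r_1)$ \[ p_{\mathrm{rad}}(r)=\widehat p_{\mathrm{rad}}(\delta(r),\eta(r)),\quad p_{\mathrm{tan}}(r)=\widehat p_{\mathrm{tan}}(\delta(r),\eta(r)),\quad \delta(r)=\frac{\rho(r)}{\mathcal{K}},\quad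 \eta(r)=\left(\frac{\mathcal{S}}{r}\right)^3+\frac{m(r)}{\frac{4\pi}{3}\mathcal{K}r^3}, \] where \[ \widehat p_{\mathrm{rad}}(\delta,\eta)=\lambda\eta^{2/3}+\frac{\lambda+2\mu}{2}\eta^{-4/3}\delta^2-p_0,\quad \widehat p_{\mathrm{tan}}(\delta,\eta)=(\lambda+\mu)\eta^{2/3}+\frac{\lambda}{2}\eta^{-4/3}\delta^2-p_0,\quad p_0=\frac{3\lambda+2\mu}{2}. \] *)

(* Defs.v *)
(* Stdlib reals with Coquelicot. *)
From Stdlib Require Export Reals.
From Coquelicot Require Export Coquelicot.
Open Scope R_scope.

(* Functions of the radius are total on [R]; only their values on [0, oo)
   are ever constrained or compared. *)

Definition C1_on_open_interval (a b : R) (f : R -> R) : Prop :=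
  forall r, a < r < b -> ex_derive f r /\ continuous (Derive f) r.

(* [continuous_on D f] is continuity of the restriction of [f] to [D], so a
   jump from outside at [a] or [b] is allowed. *)
Definition C0_on_closed_interval (a b : R) (f : R -> R) : Prop :=
  continuous_on (fun r => a <= r <= b) f.

Definition mass (r0 : R) (rho : R -> R) (r : R) : R :=
  4 * PI * RInt (fun s => rho s * s ^ 2) r0 r.

Record single_shell (r0 r1 : R) (rho prad ptan : R -> R) : Prop := {
  shell_r0_pos : 0 < r0;
  shell_r0_lt_r1 : r0 < r1;
  shell_rho_nonneg : forall r, 0 <= r -> 0 <= rho r;
  shell_Omega :
    interior (fun r => 0 < r /\ 0 < rho r) =_D (fun r => r0 < r < r1);
  shell_C1 : C1_on_open_interval r0 r1 rho /\
    C1_on_open_interval r0 r1 prad /\ C1_on_open_interval r0 r1 ptan;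
  shell_C0 : C0_on_closed_interval r0 r1 rho /\
    C0_on_closed_interval r0 r1 prad /\ C0_on_closed_interval r0 r1 ptan;
  shell_equilibrium : forall r, r0 < r < r1 ->
    Derive prad r + 2 / r * (prad r - ptan r)
      + rho r * (mass r0 rho r / r ^ 2) = 0;
  shell_pressures_pos : forall r, r0 < r < r1 -> 0 < prad r /\ 0 < ptan r;
  shell_boundary : prad r0 = 0 /\ prad r1 = 0;
  shell_vacuum : forall r, 0 <= r -> ~ (r0 <= r <= r1) ->
    rho r = 0 /\ prad r = 0 /\ ptan r = 0
}.

Definition seth_p0 (lam mu : R) : R := (3 * lam + 2 * mu) / 2.

(* [Rpower] is the usual real power only for a positive base; the functions
   below are only used at [eta > 0]. *)
Definition seth_prad (lam mu delta eta : R) : R :=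
  lam * Rpower eta (2 / 3)
  + (lam + 2 * mu) / 2 * Rpower eta (- 4 / 3) * delta ^ 2
  - seth_p0 lam mu.

Definition seth_ptan (lam mu delta eta : R) : R :=
  (lam + mu) * Rpower eta (2 / 3)
  + lam / 2 * Rpower eta (- 4 / 3) * delta ^ 2
  - seth_p0 lam mu.

Definition shell_delta (Kref : R) (rho : R -> R) (r : R) : R := rho r / Kref.

Definition shell_eta (Kref Sref r0 : R) (rho : R -> R) (r : R) : R :=
  (Sref / r) ^ 3 + mass r0 rho r / (4 * PI / 3 * Kref * r ^ 3).

Definition seth_matter (lam mu Kref Sref r0 r1 : R)
    (rho prad ptan : R -> R) : Prop :=
  forall r, r0 < r < r1 ->
    let delta := shell_delta Kref rho r in
    let eta := shell_eta Kref Sref r0 rho r in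
    prad r = seth_prad lam mu delta eta /\
    ptan r = seth_ptan lam mu delta eta.

Definition seth_shell (lam mu Kref Sref r0 r1 : R)
    (rho prad ptan : R -> R) : Prop :=
  single_shell r0 r1 rho prad ptan /\
  seth_matter lam mu Kref Sref r0 r1 rho prad ptan.

(* Main.v *)
Require Import Defs.
From Stdlib Require Import Lra Lia Psatz Classical_Pred_Type.

(** In the reference radius [x = (Sref^3 + 3 m / (4 pi Kref))^(1/3)] one has
    [eta = (x / r)^3] and [delta = (x / r)^2 x'], so with [y = x / r], [w = x']
    the pressures are quadratic in [(y, w)], and equilibrium becomes a
    second-order equation [(w^2)' = accel r x w] with [x = Sref],
    [p_rad = 0] at [r0].  The latter fixes [w (r0)^2], which is nonnegative iff
    [rmin <= r0].

    A barrier argument for [y^2 - w^2] gives [w < y], so [y' = (w - y) / r < 0]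
    and [p_tan > p_rad]; if [p_rad >= 0] then [y > 1], which yields [r0 < Sref]
    and, at the outer boundary, [r1 < x (r1)].  A barrier at
    [w^2 = c (r - r0)] keeps [w] away from [0].  Since the mass grows like
    [r^3] as long as [y >= 1], a Lyapunov function forces [p_rad] to vanish at
    a finite [r1].

    Existence and uniqueness for the equation, which is singular at [w = 0], are
    those of a Volterra fixed point for [w] itself: the map
    [w -> sqrt (q0 + int accel)] is a contraction in an exponentially weighted
    norm because of the lower bound [w^2 >= c (r - r0)]. *)

(** * Calculus and Volterra fixed points *)

(** At the minimal radius [w] starts at 0, and the right-hand side of the equation for [q = w ^ 2]
    contains [w = sqrt q], which is not Lipschitz at 0: the classical theorem fails exactly in the
    limiting case, and one argument is used for all starting values. The driving term
    [al * x ^ 2 / r ^ 3] survives at rest and forces [q >= c * (r - r0)], so the square root has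
    Lipschitz constant at most [1 / (2 * sqrt (c * (r - r0)))]. The difference of two functions [q]
    is an integral from [r0]; against the weight [exp (K * (s - r0))] it gains a factor
    [sqrt ((r - r0) / K)]. The root of [r - r0] cancels the singularity, the root of [K] makes the
    constant small.

    No continuation of solutions is needed. A bound on the outer radius depending only on the data
    comes first, and the equation is solved once on an interval of that length, with a cap on [w]
    and a floor under [q]; barriers then show that neither is active. *)

Lemma is_derive_pos_near (h : R -> R) (m d : R) :
  is_derive h m d -> 0 < d ->
  exists del, 0 < del /\
    (forall t, m - del < t < m -> h t < h m) /\
    (forall t, m < t < m + del -> h m < h t).
Proof.
  intros Hd Hpos.
  apply is_derive_Reals in Hd.
  destruct (Hd d Hpos) as [del Hdel].
  exists del; split; [apply cond_pos |].
  assert (Hq : forall t, t <> m -> Rabs (t - m) < del ->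
             0 < (h t - h m) / (t - m)).
  { intros t Ht Hlt.
    specialize (Hdel (t - m) ltac:(lra) Hlt).
    replace (m + (t - m)) with t in Hdel by ring.
    apply Rabs_def2 in Hdel; lra. }
  split; intros t Ht.
  - assert (H := Hq t ltac:(lra) ltac:(apply Rabs_def1; lra)).
    assert (h t - h m = (h t - h m) / (t - m) * (t - m)) by (field; lra).
    nra.
  - assert (H := Hq t ltac:(lra) ltac:(apply Rabs_def1; lra)).
    assert (h t - h m = (h t - h m) / (t - m) * (t - m)) by (field; lra).
    nra.
Qed.

Lemma is_derive_continuity_pt (h : R -> R) (t d : R) :
  is_derive h t d -> continuity_pt h t.
Proof.
  intros H; apply continuity_pt_filterlim.
  apply (ex_derive_continuous h t); now exists d.
Qed.

(* A minimum of [h] over [a, r] lying right of [a] with [h <= 0] would have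
   a positive derivative. *)
Lemma barrier_pos (h dh : R -> R) (a b : R) :
  (forall r, a <= r <= b -> is_derive h r (dh r)) ->
  0 <= h a ->
  (forall r, a < r <= b -> h r <= 0 -> 0 < dh r) ->
  forall r, a < r <= b -> 0 < h r.
Proof.
  intros Hd Ha Hpos r Hr.
  destruct (Rlt_le_dec 0 (h r)) as [|Hle]; [assumption | exfalso].
  assert (Hno : forall m, a < m <= r -> h m <= 0 ->
            (forall t, a <= t <= r -> h m <= h t) -> False).
  { intros m Hm Hm0 Hmin.
    destruct (is_derive_pos_near h m (dh m)) as [del [Hdel [Hl _]]].
    - apply Hd; lra.
    - apply Hpos; lra.
    - set (t := Rmax a (m - del / 2)).
      assert (a <= t /\ m - del / 2 <= t /\ t < m) as [? [? ?]].
      { unfold t; split; [apply Rmax_l | split; [apply Rmax_r |]].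
        apply Rmax_lub_lt; lra. }
      specialize (Hl t ltac:(lra)). specialize (Hmin t ltac:(lra)). lra. }
  destruct (continuity_ab_min h a r) as [m [Hmin Hm]]; [lra | |].
  - intros t Ht. apply (is_derive_continuity_pt h t (dh t)), Hd; lra.
  - assert (h m <= h r) by (apply Hmin; lra).
    destruct (Req_dec m a) as [->|Hma].
    + apply (Hno r); [lra | lra |].
      intros t Ht. specialize (Hmin t Ht). lra.
    + apply (Hno m); [lra | lra | exact Hmin].
Qed.

Lemma derive_neg_decr (h dh : R -> R) (a b k : R) :
  a <= b ->
  (forall r, a <= r <= b -> is_derive h r (dh r)) ->
  (forall r, a < r < b -> dh r <= k) ->
  h b - h a <= k * (b - a).
Proof.
  intros Hab Hd Hk.
  destruct (Req_dec a b) as [->|Hne]; [lra |].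
  destruct (MVT_cor2 h dh a b) as [c [Hc1 Hc2]]; [lra | |].
  - intros t Ht. apply is_derive_Reals, Hd; lra.
  - rewrite Hc1. specialize (Hk c Hc2). nra.
Qed.

(** Differentiability is asked only inside, because the radial pressure of a shell is differentiable
    only there. *)
Lemma derive_zero_const (h : R -> R) (a b : R) :
  a <= b ->
  (forall r, a <= r <= b -> continuous h r) ->
  (forall r, a < r < b -> is_derive h r 0) ->
  h b = h a.
Proof.
  intros Hab Hc Hd.
  destruct (MVT_gen h a b (fun _ => 0)) as [c [_ Hc2]].
  - intros x Hx. rewrite Rmin_left, Rmax_right in Hx by lra. now apply Hd.
  - intros x Hx. rewrite Rmin_left, Rmax_right in Hx by lra.
    now apply continuity_pt_filterlim, Hc.
  - lra.
Qed.

Lemma continuous_Rmax (f g : R -> R) (t : R) :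
  continuous f t -> continuous g t -> continuous (fun s => Rmax (f s) (g s)) t.
Proof.
  intros Hf Hg.
  apply (continuous_ext (fun s => (f s + g s + Rabs (f s - g s)) * (1 / 2))).
  - intros s. unfold Rmax, Rabs. destruct (Rle_dec _ _), (Rcase_abs _); lra.
  - apply (continuous_mult (fun s => f s + g s + Rabs (f s - g s)) (fun _ => 1 / 2));
      [| apply continuous_const].
    apply (continuous_plus (fun s => f s + g s) (fun s => Rabs (f s - g s))).
    + now apply (continuous_plus f g).
    + apply (continuous_comp (fun s => f s - g s) Rabs).
      * now apply (continuous_minus f g).
      * apply continuous_Rabs.
Qed.

Lemma continuous_Rmin (f g : R -> R) (t : R) :
  continuous f t -> continuous g t -> continuous (fun s => Rmin (f s) (g s)) t.
Proof.
  intros Hf Hg.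
  apply (continuous_ext (fun s => - Rmax (- f s) (- g s))).
  - intros s. unfold Rmax, Rmin. destruct (Rle_dec _ _), (Rle_dec _ _); lra.
  - apply (continuous_opp (fun s => Rmax (- f s) (- g s))).
    apply continuous_Rmax; now apply (continuous_opp (V := R_NormedModule)).
Qed.

(** Composing with this retraction turns a function known on [[a, b]] into one continuous on the
    whole line, so that integrals need no side conditions. *)
Definition clip (a b t : R) : R := Rmax a (Rmin t b).

Lemma clip_id a b t : a <= t <= b -> clip a b t = t.
Proof. intros. unfold clip. rewrite Rmin_left, Rmax_right; lra. Qed.

Lemma clip_bounds a b t : a <= b -> a <= clip a b t <= b.
Proof.
  intros. unfold clip. split; [apply Rmax_l |].
  apply Rmax_lub; [lra | apply Rmin_r].
Qed.

Lemma continuous_clip a b t : continuous (clip a b) t.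
Proof.
  apply continuous_Rmax; [apply continuous_const |].
  apply continuous_Rmin; [apply continuous_id | apply continuous_const].
Qed.

Lemma continuous_on_comp_clip (a b : R) (f : R -> R) :
  a <= b -> C0_on_closed_interval a b f ->
  forall t, continuous (fun s => f (clip a b s)) t.
Proof.
  intros Hab Hf t. unfold continuous.
  apply (filterlim_comp _ _ _ (clip a b) f _
           (within (fun r => a <= r <= b) (locally (clip a b t)))).
  - intros P [eps HP].
    destruct (continuous_clip a b t (ball (clip a b t) eps)) as [d Hd].
    { now exists eps. }
    exists d. intros s Hs. apply HP; [now apply Hd | now apply clip_bounds].
  - apply Hf. now apply clip_bounds.
Qed.

Lemma continuous_C0_on (f g : R -> R) (a b : R) :
  (forall r, a <= r <= b -> f r = g r) ->
  (forall r, a <= r <= b -> continuous g r) ->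
  C0_on_closed_interval a b f.
Proof.
  intros Hfg Hg r Hr. rewrite (Hfg r Hr).
  apply (filterlim_within_ext _ g).
  - intros s Hs. symmetry. now apply Hfg.
  - apply (filterlim_filter_le_1 g (filter_le_within (F := locally r) _)). now apply Hg.
Qed.

(** * Fixed points of causal contractions *)

Section Volterra.

Variables (a b Y K : R) (T : (R -> R) -> R -> R).
Hypothesis (hab : a <= b) (hY : 0 <= Y) (hK : 0 <= K).

(** The uniform bound [Y] supplies the first distance estimate in the iterations. *)
Definition admissible (u : R -> R) : Prop :=
  (forall t, continuous u t) /\ (forall t, 0 <= u t <= Y).

Hypothesis hT : forall u, admissible u -> admissible (T u).
(** Contraction by 1/2 for the weighted norm [sup |u s| * exp (- K * (s - a))], in pointwise and
    causal form: only values up to [t] enter, so uniqueness also holds on shorter intervals. *)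
Hypothesis hC : forall u v c t, admissible u -> admissible v ->
  a <= t <= b -> 0 <= c ->
  (forall s, a <= s <= t -> Rabs (u s - v s) <= c * exp (K * (s - a))) ->
  Rabs (T u t - T v t) <= c / 2 * exp (K * (t - a)).

Lemma exp_ge_1 x : 0 <= x -> 1 <= exp x.
Proof. intros. generalize (exp_ineq1_le x). lra. Qed.

Lemma le_geom_eq_0 x c : 0 <= x -> (forall n, x <= c * (1 / 2) ^ n) -> x = 0.
Proof.
  intros Hx H.
  apply Rle_antisym; [| assumption].
  apply (is_lim_seq_le (fun _ => x) (fun n => c * (1 / 2) ^ n) x 0 H).
  - apply is_lim_seq_const.
  - replace (Finite 0) with (Rbar_mult c 0) by (simpl; f_equal; ring).
    apply is_lim_seq_scal_l, is_lim_seq_geom. rewrite Rabs_pos_eq; lra.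
Qed.

Lemma admissible_dist u v t :
  admissible u -> admissible v -> Rabs (u t - v t) <= Y.
Proof.
  intros [_ Hu] [_ Hv]. specialize (Hu t). specialize (Hv t).
  apply Rabs_le. lra.
Qed.

(** Fixed points differ exactly as their images do, so each use of [hC] halves the weighted bound on
    their difference. *)
Lemma volterra_unique u v t0 :
  admissible u -> admissible v -> t0 <= b ->
  (forall t, a <= t <= t0 -> T u t = u t) ->
  (forall t, a <= t <= t0 -> T v t = v t) ->
  forall t, a <= t <= t0 -> u t = v t.
Proof.
  intros Hu Hv Ht0 Fu Fv.
  assert (H : forall n t, a <= t <= t0 ->
    Rabs (u t - v t) <= Y * (1 / 2) ^ n * exp (K * (t - a))).
  { induction n as [|n IH]; intros t Ht.
    - assert (1 <= exp (K * (t - a))) by (apply exp_ge_1; nra).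
      assert (H1 := admissible_dist u v t Hu Hv). simpl. nra.
    - rewrite <- Fu, <- Fv by lra.
      replace (Y * (1 / 2) ^ S n) with (Y * (1 / 2) ^ n / 2) by (simpl; field).
      apply hC; try assumption; [lra | |].
      + assert (0 < (1 / 2) ^ n) by (apply pow_lt; lra). nra.
      + intros s Hs. apply IH. lra. }
  intros t Ht.
  apply Rminus_diag_uniq.
  destruct (Req_dec (u t - v t) 0) as [|Hne]; [assumption | exfalso].
  apply (Rabs_no_R0 _ Hne).
  apply (le_geom_eq_0 _ (Y * exp (K * (t - a)))); [apply Rabs_pos |].
  intros n. specialize (H n t Ht). lra.
Qed.

Definition picard (n : nat) : R -> R := Nat.iter n T (fun _ => 0).

Lemma picard_admissible n : admissible (picard n).
Proof.
  induction n as [|n IH]; simpl.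
  - split; intros t; [apply continuous_const | lra].
  - now apply hT.
Qed.

Lemma picard_step n t : a <= t <= b ->
  Rabs (picard (S n) t - picard n t) <= Y * (1 / 2) ^ n * exp (K * (t - a)).
Proof.
  revert t. induction n as [|n IH]; intros t Ht.
  - assert (1 <= exp (K * (t - a))) by (apply exp_ge_1; nra).
    assert (H1 := admissible_dist (picard 1) (picard 0) t
                    (picard_admissible 1) (picard_admissible 0)).
    simpl pow. nra.
  - replace (Y * (1 / 2) ^ S n) with (Y * (1 / 2) ^ n / 2) by (simpl; field).
    apply (hC (picard (S n)) (picard n)); auto using picard_admissible.
    + assert (0 < (1 / 2) ^ n) by (apply pow_lt; lra). nra.
    + intros s Hs. apply IH. lra.
Qed.

(** The 2 sums the geometric series of the steps; the exponential is the largest weight on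
    [[a, b]]. *)
Let err : R := 2 * Y * exp (K * (b - a)).

(** The factor [1 - (1 / 2) ^ k] is the partial geometric sum, which lets the telescoping induction
    on [k] close. *)
Lemma picard_cauchy n k t : a <= t <= b ->
  Rabs (picard (n + k) t - picard n t) <= err * (1 / 2) ^ n * (1 - (1 / 2) ^ k).
Proof.
  intros Ht. induction k as [|k IH].
  - rewrite Nat.add_0_r, Rminus_diag, Rabs_R0. simpl. lra.
  - rewrite Nat.add_succ_r.
    replace (picard (S (n + k)) t - picard n t) with
      ((picard (S (n + k)) t - picard (n + k) t) + (picard (n + k) t - picard n t))
      by ring.
    eapply Rle_trans; [apply Rabs_triang |].
    assert (H := picard_step (n + k) t Ht).
    assert (exp (K * (t - a)) <= exp (K * (b - a))).
    { destruct (Req_dec (K * (t - a)) (K * (b - a))) as [->|Hne]; [lra |].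
      apply Rlt_le, exp_increasing. nra. }
    rewrite pow_add in H.
    assert (0 < (1 / 2) ^ n) by (apply pow_lt; lra).
    assert (0 < (1 / 2) ^ k) by (apply pow_lt; lra).
    assert (Y * ((1 / 2) ^ n * (1 / 2) ^ k) * exp (K * (t - a))
            <= Y * ((1 / 2) ^ n * (1 / 2) ^ k) * exp (K * (b - a))).
    { apply Rmult_le_compat_l; [| assumption].
      apply Rmult_le_pos; [assumption | nra]. }
    replace ((1 / 2) ^ S k) with ((1 / 2) ^ k / 2) by (simpl; field).
    unfold err in *. nra.
Qed.

Lemma picard_err_nonneg : 0 <= err.
Proof.
  unfold err. assert (0 < exp (K * (b - a))) by apply exp_pos. nra.
Qed.

Lemma picard_err_lim : is_lim_seq (fun n => err * (1 / 2) ^ n) 0.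
Proof.
  replace (Finite 0) with (Rbar_mult err 0) by (simpl; f_equal; ring).
  apply is_lim_seq_scal_l, is_lim_seq_geom. rewrite Rabs_pos_eq; lra.
Qed.

Lemma picard_err_small (eps : posreal) : exists n, err * (1 / 2) ^ n < eps.
Proof.
  destruct (proj2 (is_lim_seq_spec _ _) picard_err_lim eps) as [N HN].
  exists N. specialize (HN N (Nat.le_refl N)).
  rewrite Rminus_0_r in HN. apply Rabs_def2 in HN. lra.
Qed.

Lemma picard_dist n k t : a <= t <= b ->
  Rabs (picard (n + k) t - picard n t) <= err * (1 / 2) ^ n.
Proof.
  intros Ht. assert (H := picard_cauchy n k t Ht).
  assert (0 < (1 / 2) ^ n) by (apply pow_lt; lra).
  assert (0 < (1 / 2) ^ k) by (apply pow_lt; lra).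
  assert (HE := picard_err_nonneg).
  assert (0 <= err * (1 / 2) ^ n * (1 / 2) ^ k)
    by (apply Rmult_le_pos; [apply Rmult_le_pos |]; lra).
  lra.
Qed.

Lemma picard_lim t : a <= t <= b ->
  is_lim_seq (fun n => picard n t) (real (Lim_seq (fun n => picard n t))).
Proof.
  intros Ht. apply Lim_seq_correct'.
  apply ex_lim_seq_cauchy_corr. intros eps.
  destruct (picard_err_small (pos_div_2 eps)) as [N HN]. simpl in HN.
  exists N. intros n m Hn Hm.
  replace n with (N + (n - N))%nat by lia.
  replace m with (N + (m - N))%nat by lia.
  assert (H1 := picard_dist N (n - N) t Ht).
  assert (H2 := picard_dist N (m - N) t Ht).
  apply Rabs_le_between in H1. apply Rabs_le_between in H2.
  apply Rabs_def1; lra.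
Qed.

Lemma volterra_exists :
  exists u, admissible u /\ forall t, a <= t <= b -> T u t = u t.
Proof.
  (* The iterates are known to converge only on [[a, b]]; clipping gives a limit at every real
     [t]. *)
  set (u := fun t => real (Lim_seq (fun n => picard n (clip a b t)))).
  assert (Hclip : forall t, a <= clip a b t <= b) by (intros; now apply clip_bounds).
  assert (Hlim : forall t, is_lim_seq (fun n => picard n (clip a b t)) (u t))
    by (intros t; apply picard_lim, Hclip).
  assert (Hdist : forall n t,
            Rabs (u t - picard n (clip a b t)) <= err * (1 / 2) ^ n).
  { intros n t.
    apply (is_lim_seq_le
      (fun k => Rabs (picard (k + n) (clip a b t) - picard n (clip a b t)))
      (fun _ => err * (1 / 2) ^ n)
      (Finite (Rabs (u t - picard n (clip a b t)))) (Finite (err * (1 / 2) ^ n))).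
    - intros k. rewrite Nat.add_comm. now apply picard_dist.
    - apply (is_lim_seq_abs _ (Finite (u t - picard n (clip a b t)))).
      apply is_lim_seq_minus'; [| apply is_lim_seq_const].
      apply (is_lim_seq_incr_n (fun k => picard k (clip a b t)) n), Hlim.
    - apply is_lim_seq_const. }
  assert (Hu : admissible u).
  { split; intros t.
    - apply filterlim_locally. intros eps.
      destruct (picard_err_small (pos_div_2 (pos_div_2 eps))) as [N HN]. simpl in HN.
      assert (Hc : continuous (fun s => picard N (clip a b s)) t).
      { apply (continuous_comp (clip a b) (picard N)).
        - apply continuous_clip.
        - apply picard_admissible. }
      apply filterlim_locally with (eps := pos_div_2 eps) in Hc.
      revert Hc. apply filter_imp. intros s Hs.
      change (Rabs (picard N (clip a b s) - picard N (clip a b t)) < eps / 2) in Hs.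
      change (Rabs (u s - u t) < eps).
      assert (H1 := Hdist N s). assert (H2 := Hdist N t).
      apply Rabs_le_between in H1. apply Rabs_le_between in H2.
      apply Rabs_def2 in Hs. apply Rabs_def1; lra.
    - split.
      + apply (is_lim_seq_le (fun _ => 0) (fun n => picard n (clip a b t)) 0 (u t)).
        * intros n. apply picard_admissible.
        * apply is_lim_seq_const.
        * apply Hlim.
      + apply (is_lim_seq_le (fun n => picard n (clip a b t)) (fun _ => Y) (u t) Y).
        * intros n. apply picard_admissible.
        * apply Hlim.
        * apply is_lim_seq_const. }
  exists u. split; [assumption |].
  intros t Ht.
  apply Rminus_diag_uniq.
  destruct (Req_dec (T u t - u t) 0) as [|Hne]; [assumption | exfalso].
  apply (Rabs_no_R0 _ Hne).
  (* The two summands bound the distances of [T u] and of [u] to the iterate [T (picard n)]. *)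
  apply (le_geom_eq_0 _ (err * exp (K * (t - a)) + err)); [apply Rabs_pos |].
  intros n.
  assert (HE := picard_err_nonneg).
  assert (Hn : 0 < (1 / 2) ^ n) by (apply pow_lt; lra).
  assert (H1 : Rabs (T u t - T (picard n) t)
               <= err * (1 / 2) ^ n / 2 * exp (K * (t - a))).
  { apply hC; auto using picard_admissible.
    - apply Rmult_le_pos; lra.
    - intros s Hs.
      assert (H := Hdist n s). rewrite clip_id in H by lra.
      assert (1 <= exp (K * (s - a))) by (apply exp_ge_1; nra).
      assert (0 <= err * (1 / 2) ^ n) by (apply Rmult_le_pos; lra).
      nra. }
  assert (H2 := Hdist (S n) t). rewrite clip_id in H2 by lra.
  change (picard (S n)) with (T (picard n)) in H2.
  replace ((1 / 2) ^ S n) with ((1 / 2) ^ n / 2) in H2 by (simpl; field).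
  replace (T u t - u t) with ((T u t - T (picard n) t) - (u t - T (picard n) t)) by ring.
  eapply Rle_trans; [apply Rabs_triang |]. rewrite Rabs_Ropp.
  assert (0 < exp (K * (t - a))) by apply exp_pos.
  assert (0 <= err * (1 / 2) ^ n) by (apply Rmult_le_pos; lra).
  assert (0 <= err * (1 / 2) ^ n * exp (K * (t - a))) by (apply Rmult_le_pos; lra).
  lra.
Qed.

End Volterra.

(** * The second-order equation *)

(** Denominators leave a nonvanishing goal. Atoms go to [auto], which is why continuity at the
    current point is put into the context before the calls. *)
Ltac contin :=
  match goal with
  | |- continuous (fun s => @?f s + @?g s) _ => apply (continuous_plus f g); contin
  | |- continuous (fun s => @?f s - @?g s) _ => apply (continuous_minus f g); contin
  | |- continuous (fun s => - @?f s) _ => apply (continuous_opp f); contin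
  | |- continuous (fun s => @?f s * @?g s) _ => apply (continuous_mult f g); contin
  | |- continuous (fun s => @?f s / @?g s) _ =>
      apply (continuous_mult f (fun s => / g s)); contin
  | |- continuous (fun s => / @?f s) _ => apply (continuous_Rinv_comp f); [contin |]
  | |- continuous (fun s => @?f s ^ S ?n) _ =>
      apply (continuous_mult f (fun s => f s ^ n)); contin
  | |- continuous (fun s => _ ^ 0) _ => apply continuous_const
  | |- continuous (fun s => s) _ => apply continuous_id
  | |- continuous (fun s => ?c) _ => apply continuous_const
  | |- _ => auto
  end.

Lemma derive_pos_incr (h dh : R -> R) (a b : R) :
  a < b ->
  (forall r, a <= r <= b -> is_derive h r (dh r)) ->
  (forall r, a < r < b -> 0 < dh r) ->
  h a < h b.
Proof.
  intros Hab Hd Hk.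
  destruct (MVT_cor2 h dh a b Hab) as [c [Hc1 Hc2]].
  - intros t Ht. apply is_derive_Reals, Hd; lra.
  - specialize (Hk c Hc2). nra.
Qed.

Lemma is_derive_RInt_continuous (f : R -> R) (a t : R) :
  (forall s, continuous f s) -> is_derive (fun t => RInt f a t) t (f t).
Proof.
  intros Hf. apply (is_derive_RInt f _ a t); [| apply Hf].
  exists (mkposreal 1 Rlt_0_1). intros s _.
  apply (RInt_correct f), (ex_RInt_continuous f). auto.
Qed.

(** The [- 1] is kept because the bound must vanish at [t = a]: it is later divided by
    [sqrt (t - a)]. *)
Lemma abs_RInt_exp_le (f : R -> R) (a t C K : R) :
  a <= t -> 0 < K -> (forall s, continuous f s) ->
  (forall s, a <= s <= t -> Rabs (f s) <= C * exp (K * (s - a))) ->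
  Rabs (RInt f a t) <= C * ((exp (K * (t - a)) - 1) / K).
Proof.
  intros Hat HK Hf Hb.
  apply (norm_RInt_le f (fun s => C * exp (K * (s - a))) a t (RInt f a t)); auto.
  - apply (RInt_correct f), (ex_RInt_continuous f). auto.
  - replace (C * ((exp (K * (t - a)) - 1) / K)) with
      (minus (C * (exp (K * (t - a)) / K)) (C * (exp (K * (a - a)) / K))).
    + apply (is_RInt_derive (fun s => C * (exp (K * (s - a)) / K))).
      * intros s _. auto_derive; [exact I | change (s + - a) with (s - a); field; lra].
      * intros s _. contin.
        apply (continuous_comp (fun s => K * (s - a)) exp); [contin |].
        apply continuity_pt_filterlim, derivable_continuous_pt, derivable_pt_exp.
    + unfold minus, plus, opp; simpl.
      replace (K * (a - a)) with 0 by ring. rewrite exp_0. field. lra.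
Qed.

(** With [p] and [q] the two roots, [p ^ 2 - q ^ 2 = (p - q) * (p + q)] and both roots are at least
    [sqrt e]. *)
Lemma sqrt_Rmax_lipschitz (u v e : R) : 0 < e ->
  Rabs (sqrt (Rmax u e) - sqrt (Rmax v e)) * (2 * sqrt e) <= Rabs (u - v).
Proof.
  intros He.
  assert (Hs : 0 < sqrt e) by now apply sqrt_lt_R0.
  assert (Hu : sqrt e <= sqrt (Rmax u e)) by apply sqrt_le_1_alt, Rmax_r.
  assert (Hv : sqrt e <= sqrt (Rmax v e)) by apply sqrt_le_1_alt, Rmax_r.
  apply Rle_trans with (Rabs (Rmax u e - Rmax v e)).
  - rewrite <- (sqrt_sqrt (Rmax u e)) at 2 by (eapply Rle_trans; [| apply Rmax_r]; lra).
    rewrite <- (sqrt_sqrt (Rmax v e)) at 2 by (eapply Rle_trans; [| apply Rmax_r]; lra).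
    set (p := sqrt (Rmax u e)) in *. set (q := sqrt (Rmax v e)) in *.
    replace (p * p - q * q) with ((p - q) * (p + q)) by ring.
    rewrite Rabs_mult, (Rabs_pos_eq (p + q)) by lra.
    apply Rmult_le_compat_l; [apply Rabs_pos | lra].
  - unfold Rmax, Rabs.
    repeat (destruct (Rle_dec _ _) || destruct (Rcase_abs _)); lra.
Qed.

Lemma Rmin_contract (Y u v : R) : Rabs (Rmin Y u - Rmin Y v) <= Rabs (u - v).
Proof.
  unfold Rmin, Rabs.
  repeat (destruct (Rle_dec _ _) || destruct (Rcase_abs _)); lra.
Qed.

Section Field_equation.

Variables al be ga ka Sref r0 : R.
(** The relation [al = be + ga] makes the elastic part of [accel] vanish at [w = x / r], the
    isotropic state; it is then a multiple of [x / r - w] by a positive factor when [x] and [w] are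
    positive. *)
Hypothesis (hbe : 0 < be) (hga : 0 < ga) (hal : al = be + ga) (hka : 0 < ka)
  (hS : 0 < Sref) (hr0 : 0 < r0).

(** Equilibrium solved for [(w ^ 2)']. The last term is gravity, since [x ^ 3 - Sref ^ 3] is
    proportional to the enclosed mass; the others are elastic. *)
Definition accel (r x w : R) : R :=
  al * x ^ 2 / r ^ 3 - be * x * w / r ^ 2 - ga * w ^ 2 / r
  - ka * x ^ 2 * w * (x ^ 3 - Sref ^ 3) / r ^ 4.

(** The relation [q = w ^ 2] is deliberately left out: for the truncated problem it has to be
    proved, and the barriers need only weaker links between [q] and [w]. *)
Definition flow (b : R) (x q w : R -> R) : Prop :=
  x r0 = Sref /\
  forall r, r0 <= r <= b ->
    is_derive x r (w r) /\ is_derive q r (accel r (x r) (w r)).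

Let y0 : R := Sref / r0.

Lemma y0_pos : 0 < y0.
Proof. apply Rdiv_lt_0_compat; assumption. Qed.

Lemma y0_r0 : y0 * r0 = Sref.
Proof. unfold y0. field. lra. Qed.

Lemma accel_ratio r x w : 0 < r ->
  accel r x w =
  (al * (x / r) ^ 2 - be * (x / r) * w - ga * w ^ 2) / r
  - ka * (x / r) ^ 2 * w * (x ^ 3 - Sref ^ 3) / r ^ 2.
Proof. intros. unfold accel. field. lra. Qed.

Lemma cube_lt x z : 0 < x -> x < z -> x ^ 3 < z ^ 3.
Proof.
  intros. assert (0 < (z - x) * (x * x + x * z + z * z))
    by (apply Rmult_lt_0_compat; nra).
  lra.
Qed.

Lemma flow_x_gt b x q w r :
  flow b x q w -> (forall t, r0 < t < b -> 0 < w t) -> r0 < r <= b -> Sref < x r.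
Proof.
  intros [Hx0 Hd] Hw Hr. rewrite <- Hx0.
  apply (derive_pos_incr x w); [lra | |].
  - intros t Ht. apply Hd. lra.
  - intros t Ht. apply Hw. lra.
Qed.

Lemma is_derive_ratio (x : R -> R) (r d : R) : 0 < r ->
  is_derive x r d -> is_derive (fun r => x r / r) r ((d - x r / r) / r).
Proof.
  intros Hr Hd. auto_derive.
  - split; [now exists d | lra].
  - rewrite (is_derive_unique (fun s : R => x s) _ _ Hd). field. lra.
Qed.

(** Where [q] reaches [(x / r) ^ 2], the last hypothesis gives [w >= x / r]: the ratio does not
    decrease, the elastic part of [accel] is nonpositive, and gravity is strictly negative because
    [x > Sref]. So [(x / r) ^ 2 - q] has positive derivative there. That hypothesis also covers a
    capped [w], for which [q = w ^ 2] is not yet known. *)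
Lemma flow_upper b x q w :
  flow b x q w ->
  (forall r, r0 < r <= b -> 0 < w r) ->
  q r0 <= y0 ^ 2 ->
  (forall r, r0 < r <= b -> (x r / r) ^ 2 <= q r -> x r / r <= w r) ->
  forall r, r0 < r <= b -> q r < (x r / r) ^ 2.
Proof.
  intros Hf Hw Hq0 Himp r Hr.
  apply Rlt_0_minus.
  apply (barrier_pos (fun r => (x r / r) ^ 2 - q r)
    (fun r => 2 * (x r / r) * ((w r - x r / r) / r) - accel r (x r) (w r)) r0 b);
    [| | | exact Hr].
  - intros t Ht. destruct (proj2 Hf t Ht) as [Hx Hq].
    apply (is_derive_minus (fun r => (x r / r) ^ 2) q); [| exact Hq].
    apply (is_derive_ext (fun r => (x r / r) * (x r / r)));
      [intros; simpl; ring |].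
    assert (Hy := is_derive_ratio x t (w t) ltac:(lra) Hx).
    evar_last; [apply (is_derive_mult _ _ _ _ _ Hy Hy); intros; apply Rmult_comm |].
    unfold plus, mult; simpl. ring.
  - destruct Hf as [-> _]. fold y0. lra.
  - intros t Ht Hle.
    assert (Hyw := Himp t Ht ltac:(lra)).
    assert (HxS : Sref < x t) by (apply (flow_x_gt b x q w t Hf); [intros; apply Hw |]; lra).
    assert (Hxc := cube_lt _ _ hS HxS).
    rewrite accel_ratio by lra.
    set (y := x t / t) in *.
    assert (Hy : 0 < y) by (apply Rdiv_lt_0_compat; lra).
    clearbody y.
    assert (H1 : 0 <= 2 * y * ((w t - y) / t)).
    { apply Rmult_le_pos; [lra |]. apply Rdiv_le_0_compat; lra. }
    assert (H2 : 0 <= (be * y * w t + ga * w t ^ 2 - al * y ^ 2) / t).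
    { apply Rdiv_le_0_compat; [| lra]. rewrite hal.
      replace (be * y * w t + ga * w t ^ 2 - (be + ga) * y ^ 2)
        with (be * y * (w t - y) + ga * ((w t - y) * (w t + y))) by ring.
      apply Rplus_le_le_0_compat; repeat apply Rmult_le_pos; lra. }
    assert (H3 : 0 < ka * y ^ 2 * w t * (x t ^ 3 - Sref ^ 3) / t ^ 2).
    { specialize (Hw t Ht).
      apply Rdiv_lt_0_compat; [| apply pow_lt; lra].
      repeat apply Rmult_lt_0_compat; lra. }
    replace ((al * y ^ 2 - be * y * w t - ga * w t ^ 2) / t)
      with (- ((be * y * w t + ga * w t ^ 2 - al * y ^ 2) / t)) by (field; lra).
    lra.
Qed.

Lemma flow_ratio_decr b x q w r s :
  flow b x q w -> (forall t, r0 < t < b -> w t <= x t / t) ->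
  r0 <= r -> r <= s -> s <= b -> x s / s <= x r / r.
Proof.
  intros [_ Hd] Hw H1 H2 H3.
  assert (H := derive_neg_decr (fun r => x r / r) (fun r => (w r - x r / r) / r) r s 0 H2).
  simpl in H. rewrite Rmult_0_l in H.
  apply Rminus_le, H.
  - intros t Ht. apply is_derive_ratio; [lra |]. apply Hd. lra.
  - intros t Ht. specialize (Hw t ltac:(lra)).
    unfold Rdiv at 1. assert (0 < / t) by (apply Rinv_0_lt_compat; lra). nra.
Qed.

Lemma flow_lower b x q w c :
  flow b x q w -> 0 <= q r0 ->
  (forall r, r0 < r <= b -> q r <= c * (r - r0) -> c < accel r (x r) (w r)) ->
  forall r, r0 < r <= b -> c * (r - r0) < q r.
Proof.
  intros Hf Hq0 Hc r Hr.
  apply Rlt_0_minus.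
  apply (barrier_pos (fun r => q r - c * (r - r0))
    (fun r => accel r (x r) (w r) - c) r0 b); [| | | exact Hr].
  - intros t Ht. destruct (proj2 Hf t Ht) as [_ Hq].
    apply (is_derive_minus q (fun r => c * (r - r0)) t); [exact Hq |].
    auto_derive; [exact I | ring].
  - lra.
  - intros t Ht Hle. specialize (Hc t Ht). lra.
Qed.

(** * Uniform estimates on a compact box *)

Section Box.

Variables b Xm Y : R.
Hypothesis (hb : r0 <= b) (hXm : Sref <= Xm) (hY : 0 <= Y).

(** Boundedness is carried along because products of Lipschitz functions are Lipschitz only when the
    factors are bounded. *)
Definition bounded_lipschitz (f : R -> R -> R -> R) : Prop :=
  exists B L, 0 <= B /\ 0 <= L /\
    forall r x x' w w', r0 <= r <= b -> Sref <= x <= Xm -> Sref <= x' <= Xm ->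
      0 <= w <= Y -> 0 <= w' <= Y ->
      Rabs (f r x w) <= B /\
      Rabs (f r x w - f r x' w') <= L * (Rabs (x - x') + Rabs (w - w')).

Lemma bl_r g B : (forall r, r0 <= r <= b -> Rabs (g r) <= B) ->
  bounded_lipschitz (fun r _ _ => g r).
Proof.
  intros Hg. exists B, 0. repeat split.
  - eapply Rle_trans; [apply Rabs_pos | apply (Hg r0)]. lra.
  - lra.
  - auto.
  - rewrite Rminus_diag, Rabs_R0. lra.
Qed.

Lemma bl_x : bounded_lipschitz (fun _ x _ => x).
Proof.
  exists Xm, 1. repeat split; try lra.
  - rewrite Rabs_pos_eq; lra.
  - assert (H5 := Rabs_pos (w - w')). lra.
Qed.

Lemma bl_w : bounded_lipschitz (fun _ _ w => w).
Proof.
  exists Y, 1. repeat split; try lra.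
  - rewrite Rabs_pos_eq; lra.
  - assert (H5 := Rabs_pos (x - x')). lra.
Qed.

Lemma bl_plus f g : bounded_lipschitz f -> bounded_lipschitz g ->
  bounded_lipschitz (fun r x w => f r x w + g r x w).
Proof.
  intros [B [L [HB [HL Hf]]]] [B' [L' [HB' [HL' Hg]]]].
  exists (B + B'), (L + L'). repeat split; try lra;
    destruct (Hf r x x' w w') as [F1 F2]; auto;
    destruct (Hg r x x' w w') as [G1 G2]; auto.
  - eapply Rle_trans; [apply Rabs_triang | lra].
  - replace (f r x w + g r x w - (f r x' w' + g r x' w'))
      with ((f r x w - f r x' w') + (g r x w - g r x' w')) by ring.
    eapply Rle_trans; [apply Rabs_triang | lra].
Qed.

Lemma bl_mult f g : bounded_lipschitz f -> bounded_lipschitz g ->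
  bounded_lipschitz (fun r x w => f r x w * g r x w).
Proof.
  intros [B [L [HB [HL Hf]]]] [B' [L' [HB' [HL' Hg]]]].
  exists (B * B'), (B * L' + B' * L). repeat split; try nra;
    destruct (Hf r x x' w w') as [F1 F2]; auto;
    destruct (Hg r x x' w w') as [G1 G2]; auto;
    destruct (Hg r x' x w' w) as [G3 _]; auto.
  - rewrite Rabs_mult. apply Rmult_le_compat; auto using Rabs_pos.
  - replace (f r x w * g r x w - f r x' w' * g r x' w')
      with (f r x w * (g r x w - g r x' w') + g r x' w' * (f r x w - f r x' w')) by ring.
    eapply Rle_trans; [apply Rabs_triang |]. rewrite !Rabs_mult.
    set (D := Rabs (x - x') + Rabs (w - w')) in *.
    replace ((B * L' + B' * L) * D) with (B * (L' * D) + B' * (L * D)) by ring.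
    apply Rplus_le_compat; apply Rmult_le_compat; auto using Rabs_pos.
Qed.

Lemma bl_ext f g : (forall r x w, f r x w = g r x w) ->
  bounded_lipschitz f -> bounded_lipschitz g.
Proof.
  intros Hfg [B [L [HB [HL Hf]]]]. exists B, L.
  split; [assumption | split; [assumption |]].
  intros. rewrite <- !Hfg. auto.
Qed.

Lemma bl_const c : bounded_lipschitz (fun _ _ _ => c).
Proof. apply (bl_r (fun _ => c) (Rabs c)). intros. lra. Qed.

Lemma bl_inv : bounded_lipschitz (fun r _ _ => / r).
Proof.
  apply (bl_r (fun r => / r) (/ r0)). intros r Hr.
  rewrite Rabs_pos_eq by (apply Rlt_le, Rinv_0_lt_compat; lra).
  apply Rinv_le_contravar; lra.
Qed.

(** Every term of [accel] except the driving one contains a factor [w]; this is the cofactor, so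
    [accel] stays positive near rest. *)
Definition drag (r x w : R) : R :=
  be * x / r ^ 2 + ga * w / r + ka * x ^ 2 * (x ^ 3 - Sref ^ 3) / r ^ 4.

Lemma accel_drag r x w : accel r x w = al * x ^ 2 / r ^ 3 - w * drag r x w.
Proof. unfold accel, drag, Rdiv. ring. Qed.

Lemma bl_pow f n : bounded_lipschitz f ->
  bounded_lipschitz (fun r x w => f r x w ^ n).
Proof.
  intros Hf. induction n as [|n IH]; simpl; auto using bl_const, bl_mult.
Qed.

Lemma drag_bl : bounded_lipschitz drag.
Proof.
  apply (bl_ext (fun r x w => be * x * (/ r) ^ 2 + ga * w * / r
    + ka * x ^ 2 * (x ^ 3 + - Sref ^ 3) * (/ r) ^ 4)).
  - intros. unfold drag, Rdiv. rewrite !pow_inv. ring.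
  - repeat (apply bl_plus || apply bl_mult || apply bl_const || apply bl_inv
      || apply bl_x || apply bl_w
      || apply (bl_pow (fun _ x _ => x)) || apply (bl_pow (fun r _ _ => / r))).
Qed.

Lemma accel_bl : bounded_lipschitz accel.
Proof.
  apply (bl_ext (fun r x w => al * x ^ 2 * (/ r) ^ 3 + (-1) * w * drag r x w)).
  - intros. rewrite accel_drag. unfold Rdiv. rewrite !pow_inv. ring.
  - repeat (exact drag_bl || apply bl_plus || apply bl_mult || apply bl_const || apply bl_inv
      || apply bl_x || apply bl_w 
      || apply (bl_pow (fun _ x _ => x)) || apply (bl_pow (fun r _ _ => / r))).
Qed.

Lemma accel_pos_small_w : exists c, 0 < c /\
  forall r x w, r0 <= r <= b -> Sref <= x <= Xm -> 0 <= w <= Y ->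
    w ^ 2 <= c * (r - r0) -> c < accel r x w.
Proof.
  destruct drag_bl as [B [L [HB [_ Hdrag]]]].
  set (d := al * Sref ^ 2 / b ^ 3).
  assert (Hd : 0 < d).
  { assert (0 < Sref ^ 2) by now apply pow_lt.
    assert (0 < b ^ 3) by (apply pow_lt; lra).
    apply Rdiv_lt_0_compat; [apply Rmult_lt_0_compat; lra | assumption]. }
  (* For [w <= m] the drag takes away at most half of [d], the least driving term on the box. *)
  set (m := d / (2 * (B + 1))).
  assert (Hm : 0 < m) by (apply Rdiv_lt_0_compat; lra).
  (* The first bound puts [c] below the remaining [d / 2]; the second makes [w ^ 2 <= c * (r - r0)]
     imply [w <= m]. *)
  set (c := Rmin (d / 4) (m ^ 2 / (b - r0 + 1))).
  assert (Hmb : 0 < m ^ 2 / (b - r0 + 1))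
    by (apply Rdiv_lt_0_compat; [apply pow_lt |]; lra).
  assert (Hc : 0 < c) by (apply Rmin_pos; lra).
  exists c. split; [assumption |].
  intros r x w Hr Hx Hw Hsmall.
  assert (Hwm : w <= m).
  { apply Rnot_lt_le. intros Hlt.
    assert (m ^ 2 < w ^ 2) by nra.
    assert (Hc2 : c <= m ^ 2 / (b - r0 + 1)) by apply Rmin_r.
    assert (c * (r - r0) <= m ^ 2 / (b - r0 + 1) * (b - r0 + 1))
      by (apply Rmult_le_compat; lra).
    replace (m ^ 2 / (b - r0 + 1) * (b - r0 + 1)) with (m ^ 2) in * by (field; lra).
    lra. }
  assert (Hd1 : d <= al * x ^ 2 / r ^ 3).
  { unfold d, Rdiv. apply Rmult_le_compat.
    - apply Rmult_le_pos; [lra | apply pow_le; lra].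
    - apply Rlt_le, Rinv_0_lt_compat, pow_lt; lra.
    - apply Rmult_le_compat_l; [lra | apply pow_incr; lra].
    - apply Rinv_le_contravar; [apply pow_lt; lra | apply pow_incr; lra]. }
  destruct (Hdrag r x x w w Hr Hx Hx Hw Hw) as [HD _].
  apply Rabs_le_between in HD.
  assert (w * drag r x w <= m * B) by nra.
  assert (m * (B + 1) = d / 2) by (unfold m; field; lra).
  assert (Hc1 : c <= d / 4) by apply Rmin_l.
  rewrite accel_drag. lra.
Qed.

End Box.

(* Once [x >= r] the mass is comparable with [r^3], and gravity makes the
   Lyapunov function [A q + x - r] decrease at rate [1/2]. *)
Lemma flow_bounded : exists Rm, r0 < Rm /\
  forall b x q w, r0 <= b -> flow b x q w ->
    (forall r, r0 <= r <= b ->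
       0 <= w r /\ 0 <= q r <= y0 ^ 2 /\ x r / r <= y0 /\ 1 <= x r / r) ->
    b < Rm.
Proof.
  assert (Hy0 := y0_pos).
  (* Beyond [2 * Sref] the subtracted [Sref ^ 3] costs at most half of [t ^ 3]. The last summand, at
     least 1, makes [ka * R1 ^ 2] dominate the elastic term. *)
  set (R1 := r0 + 2 * Sref + (4 * al * y0 ^ 2 / ka + 1)).
  assert (Hpos : 0 < 4 * al * y0 ^ 2 / ka).
  { apply Rdiv_lt_0_compat; [| assumption].
    apply Rmult_lt_0_compat; [lra | now apply pow_lt]. }
  assert (HR1a : 4 * al * y0 ^ 2 <= ka * R1 ^ 2).
  { assert (4 * al * y0 ^ 2 / ka <= R1 ^ 2) by (unfold R1; nra).
    replace (4 * al * y0 ^ 2) with (ka * (4 * al * y0 ^ 2 / ka)) by (field; lra).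
    apply Rmult_le_compat_l; lra. }
  assert (HR1b : r0 < R1 /\ 2 * Sref < R1) by (unfold R1; lra).
  clearbody R1.
  (* With this weight the lower bound [ka * w * (R1 / 2)] on gravity cancels the growth [x' = w]
     exactly. *)
  set (A := 2 / (ka * R1)).
  assert (HkR : 0 < ka * R1) by (apply Rmult_lt_0_compat; lra).
  assert (HA : 0 < A) by (apply Rdiv_lt_0_compat; lra).
  (* The Lyapunov function is at most [A * y0 ^ 2 + y0 * R1] at [R1] and nonnegative at [b]; its
     decay rate 1/2 yields the factor 2. *)
  exists (R1 + 2 * (A * y0 ^ 2 + y0 * R1) + 1).
  assert (0 < A * y0 ^ 2) by (apply Rmult_lt_0_compat; [|apply pow_lt]; lra).
  assert (0 < y0 * R1) by (apply Rmult_lt_0_compat; lra).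
  split; [lra |].
  intros b x q w Hb [_ Hd] Hbd.
  destruct (Rle_lt_dec b R1) as [|HbR]; [lra |].
  assert (HV := derive_neg_decr (fun r => A * q r + x r - r)
     (fun r => A * accel r (x r) (w r) + w r - 1) R1 b (- (1 / 2)) ltac:(lra)).
  simpl in HV.
  assert (HV' : A * q b + x b - b - (A * q R1 + x R1 - R1) <= - (1 / 2) * (b - R1)).
  { apply HV.
    - intros t Ht. destruct (Hd t ltac:(lra)) as [Hx Hq].
      auto_derive.
      + split; [now exists (accel t (x t) (w t)) | split; [now exists (w t) | exact I]].
      + rewrite (is_derive_unique (fun s : R => q s) _ _ Hq).
        rewrite (is_derive_unique (fun s : R => x s) _ _ Hx). ring.
    - intros t Ht.
      destruct (Hbd t ltac:(lra)) as [Hw [_ [Hy1 Hy2]]].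
      rewrite accel_ratio by lra.
      assert (Hx : t <= x t).
      { replace (x t) with (x t / t * t) by (field; lra). nra. }
      set (y := x t / t) in *. clearbody y.
      assert (Hy : 1 <= y ^ 2 <= y0 ^ 2) by (split; nra).
      assert (Hc : t ^ 3 / 2 <= x t ^ 3 - Sref ^ 3).
      { assert (t ^ 3 <= x t ^ 3) by (apply pow_incr; lra).
        assert ((2 * Sref) ^ 3 <= t ^ 3) by (apply pow_incr; lra).
        assert (0 < Sref ^ 3) by (now apply pow_lt). nra. }
      assert (H1 : (al * y ^ 2 - be * y * w t - ga * w t ^ 2) / t <= al * y0 ^ 2 / R1).
      { apply Rle_trans with (al * y0 ^ 2 / t).
        - unfold Rdiv. apply Rmult_le_compat_r.
          + apply Rlt_le, Rinv_0_lt_compat; lra.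
          + assert (0 <= be * y * w t) by (repeat apply Rmult_le_pos; lra).
            assert (0 <= ga * w t ^ 2) by (apply Rmult_le_pos; [|apply pow_le]; lra).
            nra.
        - unfold Rdiv. apply Rmult_le_compat_l; [nra |].
          apply Rinv_le_contravar; lra. }
      assert (H2 : ka * w t * (R1 / 2) <= ka * y ^ 2 * w t * (x t ^ 3 - Sref ^ 3) / t ^ 2).
      { replace (ka * y ^ 2 * w t * (x t ^ 3 - Sref ^ 3) / t ^ 2)
          with (ka * w t * (y ^ 2 * ((x t ^ 3 - Sref ^ 3) / t ^ 2))) by (field; lra).
        apply Rmult_le_compat_l; [apply Rmult_le_pos; lra |].
        assert (R1 / 2 <= (x t ^ 3 - Sref ^ 3) / t ^ 2).
        { apply Rle_trans with (t / 2); [lra |].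
          replace (t / 2) with ((t ^ 3 / 2) / t ^ 2) by (field; lra).
          unfold Rdiv at 1 3. apply Rmult_le_compat_r; [| assumption].
          apply Rlt_le, Rinv_0_lt_compat, pow_lt; lra. }
        nra. }
      assert (HA1 : A * (ka * w t * (R1 / 2)) = w t) by (unfold A; field; lra).
      assert (HA2 : A * (al * y0 ^ 2 / R1) <= 1 / 2).
      { replace (A * (al * y0 ^ 2 / R1)) with (2 * al * y0 ^ 2 / (ka * R1 ^ 2))
          by (unfold A; field; lra).
        apply Rle_div_l; [apply Rlt_gt, Rmult_lt_0_compat; [|apply pow_lt]; lra | lra]. }
      nra. }
  destruct (Hbd b ltac:(lra)) as [_ [Hqb [_ Hyb]]].
  destruct (Hbd R1 ltac:(lra)) as [_ [Hq1 [Hy1 _]]].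
  assert (b <= x b).
  { replace (x b) with (x b / b * b) by (field; lra). nra. }
  assert (x R1 <= y0 * R1).
  { replace (x R1) with (x R1 / R1 * R1) by (field; lra). nra. }
  assert (0 <= A * q b) by (apply Rmult_le_pos; lra).
  assert (A * q R1 <= A * y0 ^ 2) by (apply Rmult_le_compat_l; lra).
  lra.
Qed.

Lemma continuous_accel (g x w : R -> R) t :
  g t <> 0 -> continuous g t -> continuous x t -> continuous w t ->
  continuous (fun s => accel (g s) (x s) (w s)) t.
Proof.
  intros Hg0 Hg Hx Hw. unfold accel. contin; auto using pow_nonzero.
Qed.

(** * The truncated fixed-point map *)

Section Truncation.

Variables Rm q0 c : R.
Hypothesis (hRm : r0 < Rm) (hq0 : 0 <= q0 <= y0 ^ 2) (hc : 0 < c).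

(** The farthest position reachable at [Rm] with speed at most [y0]. *)
Let Xm : R := Sref + y0 * (Rm - r0).

Hypothesis hcF : forall r x w, r0 <= r <= Rm -> Sref <= x <= Xm -> 0 <= w <= y0 ->
  w ^ 2 <= c * (r - r0) -> c < accel r x w.

Definition reach (u : R -> R) (t : R) : R := Sref + RInt u r0 t.

(** Clipping the radius keeps the denominators of [accel] away from 0, so the integrand is
    continuous on the whole line. *)
Definition speed2 (u : R -> R) (t : R) : R :=
  q0 + RInt (fun s => accel (clip r0 Rm s) (reach u s) (u s)) r0 t.

(* The floor [c * (t - r0)] keeps the square root Lipschitz also when the
   motion starts from rest; it is never active along a fixed point. *)
Definition speed_map (u : R -> R) (t : R) : R :=
  Rmin y0 (sqrt (Rmax (speed2 u t) (c * (t - r0)))).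

Lemma is_derive_reach u t :
  (forall s, continuous u s) -> is_derive (reach u) t (u t).
Proof.
  intros Hu. unfold reach.
  evar_last;
    [apply (is_derive_plus (fun _ => Sref) (RInt u r0));
      [apply is_derive_const | now apply is_derive_RInt_continuous] |].
  apply plus_zero_l.
Qed.

Lemma reach_r0 u : reach u r0 = Sref.
Proof. unfold reach. rewrite RInt_point. apply Rplus_0_r. Qed.

Lemma continuous_reach u t : (forall s, continuous u s) -> continuous (reach u) t.
Proof.
  intros Hu. apply (ex_derive_continuous (reach u) t).
  exists (u t). now apply is_derive_reach.
Qed.

Lemma continuous_speed2_rate u t : (forall s, continuous u s) ->
  continuous (fun s => accel (clip r0 Rm s) (reach u s) (u s)) t.
Proof.
  intros Hu. apply (continuous_accel (clip r0 Rm)); auto using continuous_reach.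
  - assert (H := clip_bounds r0 Rm t). lra.
  - apply continuous_clip.
Qed.

Lemma is_derive_speed2 u t : (forall s, continuous u s) ->
  is_derive (speed2 u) t (accel (clip r0 Rm t) (reach u t) (u t)).
Proof.
  intros Hu. unfold speed2.
  evar_last;
    [apply (is_derive_plus (fun _ => q0)
       (RInt (fun s => accel (clip r0 Rm s) (reach u s) (u s)) r0));
      [apply is_derive_const
      | apply (is_derive_RInt_continuous
          (fun s => accel (clip r0 Rm s) (reach u s) (u s)));
        intros; now apply continuous_speed2_rate] |].
  apply plus_zero_l.
Qed.

Lemma speed2_r0 u : speed2 u r0 = q0.
Proof. unfold speed2. rewrite RInt_point. apply Rplus_0_r. Qed.

Lemma flow_reach_speed2 u : (forall s, continuous u s) ->
  flow Rm (reach u) (speed2 u) u.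
Proof.
  intros Hu. split; [apply reach_r0 |].
  intros r Hr. split; [now apply is_derive_reach |].
  rewrite <- (clip_id r0 Rm r Hr) at 2. now apply is_derive_speed2.
Qed.

Lemma reach_bounds u t : admissible y0 u -> r0 <= t <= Rm ->
  Sref <= reach u t <= Sref + y0 * (t - r0).
Proof.
  intros [Hu Hb] Ht.
  assert (H1 := derive_neg_decr (fun t => - reach u t) (fun t => - u t) r0 t 0).
  assert (H2 := derive_neg_decr (reach u) u r0 t y0).
  simpl in H1. rewrite reach_r0 in H1, H2. split.
  - enough (- reach u t - - Sref <= 0 * (t - r0)) by lra.
    apply H1; [lra | |].
    + intros r _. apply (is_derive_opp (reach u)). now apply is_derive_reach.
    + intros r _. specialize (Hb r). lra.
  - enough (reach u t - Sref <= y0 * (t - r0)) by lra.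
    apply H2; [lra | |].
    + intros r _. now apply is_derive_reach.
    + intros r _. apply Hb.
Qed.

Lemma speed_map_admissible u : admissible y0 u -> admissible y0 (speed_map u).
Proof.
  intros [Hu _]. split; intros t.
  - apply (continuous_Rmin (fun _ => y0)); [apply continuous_const |].
    apply (continuous_comp (fun t => Rmax (speed2 u t) (c * (t - r0))) sqrt);
      [| apply continuous_sqrt].
    apply continuous_Rmax; [| contin].
    apply (ex_derive_continuous (speed2 u) t).
    eexists. now apply is_derive_speed2.
  - assert (H := y0_pos). unfold speed_map. split; [| apply Rmin_l].
    apply Rmin_glb; [lra | apply sqrt_pos].
Qed.

Lemma Xm_ge : Sref <= Xm.
Proof. assert (H := y0_pos). unfold Xm. nra. Qed.

(** For [K >= 1] integrating the weight does not enlarge it, so positions inherit the bound on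
    speeds; hence twice the Lipschitz constant of [accel]. *)
Lemma speed2_dist : exists L, 0 <= L /\ forall u v C K t,
  admissible y0 u -> admissible y0 v -> r0 <= t <= Rm -> 0 <= C -> 1 <= K ->
  (forall s, r0 <= s <= t -> Rabs (u s - v s) <= C * exp (K * (s - r0))) ->
  Rabs (speed2 u t - speed2 v t) <= L * C * ((exp (K * (t - r0)) - 1) / K).
Proof.
  assert (Hy0 := y0_pos). assert (HXm := Xm_ge).
  destruct (accel_bl Rm Xm y0) as [B [L [_ [HL Hlip]]]]; [lra .. |].
  exists (2 * L). split; [lra |].
  intros u v C K t Hu Hv Ht HC HK H.
  assert (Hxx : forall s, r0 <= s <= t ->
            Rabs (reach u s - reach v s) <= C * exp (K * (s - r0))).
  { intros s Hs.
    replace (reach u s - reach v s) with (RInt (fun z => u z - v z) r0 s).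
    - eapply Rle_trans; [apply (abs_RInt_exp_le _ r0 s C K) |]; [lra | lra | | |].
      + intros z. apply (continuous_minus u v); [apply Hu | apply Hv].
      + intros z Hz. apply H. lra.
      + apply Rmult_le_compat_l; [assumption |].
        assert (1 <= exp (K * (s - r0))) by (apply exp_ge_1, Rmult_le_pos; lra).
        apply Rle_div_l; [lra |]. nra.
    - rewrite (RInt_minus u v).
      + unfold reach, minus, plus, opp; simpl. ring.
      + apply (ex_RInt_continuous u). intros; apply Hu.
      + apply (ex_RInt_continuous v). intros; apply Hv. }
  set (fu := fun s => accel (clip r0 Rm s) (reach u s) (u s)).
  set (fv := fun s => accel (clip r0 Rm s) (reach v s) (v s)).
  assert (Hfu : forall s, continuous fu s)
    by (intros; apply continuous_speed2_rate, Hu).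
  assert (Hfv : forall s, continuous fv s)
    by (intros; apply continuous_speed2_rate, Hv).
  replace (speed2 u t - speed2 v t) with (RInt (fun s => fu s - fv s) r0 t).
  - apply abs_RInt_exp_le; [lra | lra | |].
    + intros s. now apply (continuous_minus fu fv).
    + intros s Hs. unfold fu, fv. rewrite clip_id by lra.
      assert (Hbu := reach_bounds u s Hu ltac:(lra)).
      assert (Hbv := reach_bounds v s Hv ltac:(lra)).
      assert (y0 * (s - r0) <= y0 * (Rm - r0)) by (apply Rmult_le_compat_l; lra).
      destruct (Hlip s (reach u s) (reach v s) (u s) (v s)) as [_ HF].
      * lra.
      * unfold Xm; lra.
      * unfold Xm; lra.
      * apply Hu.
      * apply Hv.
      * specialize (Hxx s Hs). specialize (H s ltac:(lra)).
        eapply Rle_trans; [exact HF |].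
        replace (2 * L * C * exp (K * (s - r0)))
          with (L * (C * exp (K * (s - r0)) + C * exp (K * (s - r0)))) by ring.
        apply Rmult_le_compat_l; lra.
  - rewrite (RInt_minus fu fv).
    + unfold speed2, minus, plus, opp; simpl. fold fu fv. ring.
    + now apply (ex_RInt_continuous fu).
    + now apply (ex_RInt_continuous fv).
Qed.

(** Since [1 - exp (- z)] is at most both 1 and [z], it is at most [sqrt z]. The root is what
    compensates the Lipschitz constant of the square root near [r0]. *)
Lemma exp_sub_1_le z : 0 <= z -> exp z - 1 <= exp z * sqrt z.
Proof.
  intros Hz.
  assert (Hs := sqrt_pos z). assert (Hss := sqrt_sqrt z Hz).
  assert (He := exp_pos z).
  assert (H : 1 - z <= exp (- z)) by (generalize (exp_ineq1_le (- z)); lra).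
  assert (Hp : exp z * exp (- z) = 1) by (rewrite <- exp_plus, Rplus_opp_r; apply exp_0).
  destruct (Rle_lt_dec 1 (sqrt z)) as [H1|H1]; nra.
Qed.

Lemma speed_map_contracts : exists K, 0 <= K /\ forall u v C t,
  admissible y0 u -> admissible y0 v -> r0 <= t <= Rm -> 0 <= C ->
  (forall s, r0 <= s <= t -> Rabs (u s - v s) <= C * exp (K * (s - r0))) ->
  Rabs (speed_map u t - speed_map v t) <= C / 2 * exp (K * (t - r0)).
Proof.
  destruct speed2_dist as [L [HL Hdist]].
  (* This gives [L <= sqrt c * sqrt K], exactly what a contraction factor 1/2 requires. *)
  set (K := L ^ 2 / c + 1).
  assert (HK : 1 <= K).
  { assert (0 <= L ^ 2 / c) by (apply Rdiv_le_0_compat; [apply pow_le |]; lra).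
    unfold K; lra. }
  exists K. split; [lra |].
  intros u v C t Hu Hv Ht HC H.
  assert (He := exp_pos (K * (t - r0))).
  (* At [r0] the Lipschitz estimate degenerates, but both images take the same value there. *)
  destruct (Req_dec t r0) as [->|Hne].
  - unfold speed_map. rewrite !speed2_r0, Rminus_diag, Rabs_R0.
    apply Rmult_le_pos; lra.
  - set (tau := t - r0) in *. assert (Htau : 0 < tau) by (unfold tau; lra).
    unfold speed_map. fold tau.
    eapply Rle_trans; [apply Rmin_contract |].
    assert (Hct : 0 < c * tau) by now apply Rmult_lt_0_compat.
    assert (Hsq := sqrt_Rmax_lipschitz (speed2 u t) (speed2 v t) _ Hct).
    specialize (Hdist u v C K t Hu Hv ltac:(lra) HC HK H). fold tau in Hdist.
    assert (Hexp := exp_sub_1_le (K * tau) ltac:(nra)).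
    rewrite sqrt_mult in Hexp by lra. rewrite sqrt_mult in Hsq by lra.
    assert (Hc0 : 0 < sqrt c) by now apply sqrt_lt_R0.
    assert (Ht0 : 0 < sqrt tau) by now apply sqrt_lt_R0.
    assert (HK0 : 0 < sqrt K) by (apply sqrt_lt_R0; lra).
    assert (HLK : L <= sqrt c * sqrt K).
    { rewrite <- sqrt_mult by lra. rewrite <- (sqrt_pow2 L) by lra.
      apply sqrt_le_1_alt. unfold K. rewrite Rmult_plus_distr_l.
      replace (c * (L ^ 2 / c)) with (L ^ 2) by (field; lra). lra. }
    assert (HKK : sqrt K * sqrt K = K) by (apply sqrt_sqrt; lra).
    set (D := Rabs (_ - _)) in Hsq |- *.
    apply (Rmult_le_reg_r (2 * (sqrt c * sqrt tau))); [nra |].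
    eapply Rle_trans; [exact Hsq |]. eapply Rle_trans; [exact Hdist |].
    set (e := exp (K * tau)) in *.
    apply Rle_trans with (L * C * (e * sqrt tau / sqrt K)).
    + apply Rmult_le_compat_l; [now apply Rmult_le_pos |].
      apply Rle_div_l; [lra |].
      replace (e * sqrt tau / sqrt K * K) with (e * (sqrt K * sqrt tau)); [lra |].
      transitivity (e * sqrt tau / sqrt K * (sqrt K * sqrt K)); [field; lra |].
      now rewrite HKK.
    + replace (L * C * (e * sqrt tau / sqrt K)) with (L / sqrt K * (C * e * sqrt tau))
        by (field; lra).
      replace (C / 2 * e * (2 * (sqrt c * sqrt tau)))
        with (sqrt c * (C * e * sqrt tau)) by field.
      apply Rmult_le_compat_r.
      * repeat apply Rmult_le_pos; lra.
      * apply Rle_div_l; lra.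
Qed.

(** The implication below the floor holds for fixed points of [speed_map] and for flows with
    [q = w ^ 2], so this serves both existence and uniqueness. *)
Lemma speed_map_floor u : admissible y0 u ->
  (forall r, r0 < r <= Rm -> speed2 u r <= c * (r - r0) -> u r ^ 2 <= c * (r - r0)) ->
  forall r, r0 < r <= Rm -> c * (r - r0) < speed2 u r.
Proof.
  intros Hu Himp. assert (Hy0 := y0_pos).
  apply (flow_lower Rm (reach u) (speed2 u) u).
  - apply flow_reach_speed2, Hu.
  - rewrite speed2_r0. lra.
  - intros r Hr Hle. apply hcF; [lra | | apply Hu | now apply Himp].
    assert (H := reach_bounds u r Hu ltac:(lra)).
    assert (y0 * (r - r0) <= y0 * (Rm - r0)) by (apply Rmult_le_compat_l; lra).
    unfold Xm. lra.
Qed.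

(** The floor goes first: where [speed2] does not exceed it, the fixed-point equation gives
    [u ^ 2 <= c * (r - r0)], and [accel] is then too large. What remains is
    [u = Rmin y0 (sqrt (speed2 u))], to which [flow_upper] applies; it yields
    [speed2 < (x / r) ^ 2 <= y0 ^ 2], so the cap is inactive too. *)
Lemma speed_map_fixed_flow u : admissible y0 u ->
  (forall t, r0 <= t <= Rm -> speed_map u t = u t) ->
  forall r, r0 <= r <= Rm -> speed2 u r = u r ^ 2 /\
    (r0 < r -> 0 < u r < reach u r / r).
Proof.
  intros Hu Hfix. assert (Hy0 := y0_pos). assert (Hyr := y0_r0).
  assert (Hflow := flow_reach_speed2 u (proj1 Hu)).
  assert (Hfloor : forall r, r0 < r <= Rm -> c * (r - r0) < speed2 u r).
  { apply speed_map_floor; [assumption |].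
    intros r Hr Hle. rewrite <- Hfix by lra. unfold speed_map.
    rewrite Rmax_right by assumption.
    assert (0 <= c * (r - r0)) by (apply Rmult_le_pos; lra).
    rewrite <- (sqrt_sqrt (c * (r - r0))) at 2 by assumption.
    rewrite <- Rsqr_pow2. apply Rsqr_incr_1; [apply Rmin_r | | apply sqrt_pos].
    apply Rmin_glb; [lra | apply sqrt_pos]. }
  assert (Hmin : forall r, r0 <= r <= Rm -> u r = Rmin y0 (sqrt (speed2 u r))).
  { intros r Hr. rewrite <- Hfix at 1 by assumption. unfold speed_map.
    rewrite Rmax_left; [reflexivity |].
    destruct (Req_dec r r0) as [->|Hne].
    - rewrite speed2_r0. lra.
    - apply Rlt_le, Hfloor. lra. }
  assert (Hpos : forall r, r0 < r <= Rm -> 0 < speed2 u r).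
  { intros r Hr. specialize (Hfloor r Hr).
    assert (0 < c * (r - r0)) by (apply Rmult_lt_0_compat; lra). lra. }
  assert (Hupos : forall r, r0 < r <= Rm -> 0 < u r).
  { intros r Hr. rewrite Hmin by lra.
    apply Rmin_pos; [assumption |]. now apply sqrt_lt_R0, Hpos. }
  (* Speed at most [y0] and start [Sref = y0 * r0] give [x <= y0 * r]. *)
  assert (Hyle : forall r, r0 < r <= Rm -> 0 < reach u r / r <= y0).
  { intros r Hr. assert (H := reach_bounds u r Hu ltac:(lra)). split.
    - apply Rdiv_lt_0_compat; lra.
    - apply Rle_div_l; nra. }
  assert (Hupper : forall r, r0 < r <= Rm -> speed2 u r < (reach u r / r) ^ 2).
  { apply (flow_upper Rm _ _ u Hflow Hupos).
    - rewrite speed2_r0. apply hq0.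
    - intros r Hr Hle. rewrite (Hmin r) by lra.
      apply Rmin_glb; [apply Hyle; lra |].
      rewrite <- (sqrt_pow2 (reach u r / r)) by (apply Rlt_le, Hyle; lra).
      now apply sqrt_le_1_alt. }
  assert (Hsq : forall r, r0 <= r <= Rm -> u r = sqrt (speed2 u r)).
  { intros r Hr. rewrite Hmin by assumption. apply Rmin_right.
    rewrite <- (sqrt_pow2 y0) by lra. apply sqrt_le_1_alt.
    destruct (Req_dec r r0) as [->|Hne].
    - rewrite speed2_r0. lra.
    - specialize (Hupper r ltac:(lra)). specialize (Hyle r ltac:(lra)). nra. }
  intros r Hr.
  assert (Hq : speed2 u r = u r ^ 2).
  { rewrite (Hsq r Hr), pow2_sqrt; [reflexivity |].
    destruct (Req_dec r r0) as [->|Hne].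
    - rewrite speed2_r0. lra.
    - apply Rlt_le, Hpos. lra. }
  split; [assumption |].
  intros Hr'. specialize (Hupos r ltac:(lra)). specialize (Hupper r ltac:(lra)).
  specialize (Hyle r ltac:(lra)). rewrite Hq in Hupper. split; [assumption | nra].
Qed.

Lemma flow_eq_reach x q w : flow Rm x q w -> (forall s, continuous w s) ->
  q r0 = q0 ->
  forall r, r0 <= r <= Rm -> x r = reach w r /\ q r = speed2 w r.
Proof.
  intros Hf Hw Hq0.
  assert (Hg := flow_reach_speed2 w Hw).
  assert (Hx : forall r, r0 <= r <= Rm -> x r = reach w r).
  { intros r Hr.
    assert (Hder : forall s, r0 <= s <= r -> is_derive (fun s => x s - reach w s) s 0).
    { intros s Hs. rewrite <- (Rminus_diag (w s)).
      apply (is_derive_minus x (reach w)); [apply Hf | apply Hg]; lra. }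
    assert (H : x r - reach w r = x r0 - reach w r0).
    { apply (derive_zero_const (fun s => x s - reach w s)); [lra | |].
      - intros s Hs. apply (ex_derive_continuous (fun s => x s - reach w s) s).
        eexists. now apply Hder.
      - intros s Hs. apply Hder. lra. }
    rewrite (proj1 Hf), (proj1 Hg) in H. lra. }
  intros r Hr. split; [now apply Hx |].
  assert (Hder : forall s, r0 <= s <= r -> is_derive (fun s => q s - speed2 w s) s 0).
  { intros s Hs. rewrite <- (Rminus_diag (accel s (x s) (w s))).
    apply (is_derive_minus q (speed2 w)); [apply Hf; lra |].
    rewrite Hx by lra. apply Hg; lra. }
  assert (H : q r - speed2 w r = q r0 - speed2 w r0).
  { apply (derive_zero_const (fun s => q s - speed2 w s)); [lra | |].
    - intros s Hs. apply (ex_derive_continuous (fun s => q s - speed2 w s) s).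
      eexists. now apply Hder.
    - intros s Hs. apply Hder. lra. }
  rewrite speed2_r0 in H. lra.
Qed.

Lemma flow_floor x q w : flow Rm x q w -> admissible y0 w -> q r0 = q0 ->
  (forall r, r0 <= r <= Rm -> q r = w r ^ 2) ->
  forall r, r0 < r <= Rm -> c * (r - r0) < q r.
Proof.
  intros Hf Hw Hq0 Hq r Hr.
  assert (Heq := flow_eq_reach x q w Hf (proj1 Hw) Hq0).
  destruct (Heq r ltac:(lra)) as [_ ->].
  apply speed_map_floor; [assumption | | assumption].
  intros s Hs Hle. destruct (Heq s ltac:(lra)) as [_ H].
  rewrite <- Hq by lra. lra.
Qed.

(** Reduces uniqueness of flows to [volterra_unique]. *)
Lemma flow_speed_map_fixed x q w : flow Rm x q w -> admissible y0 w -> q r0 = q0 ->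
  (forall r, r0 <= r <= Rm -> q r = w r ^ 2) ->
  forall r, r0 <= r <= Rm -> speed_map w r = w r.
Proof.
  intros Hf Hw Hq0 Hq r Hr. unfold speed_map.
  destruct (flow_eq_reach x q w Hf (proj1 Hw) Hq0 r Hr) as [_ <-].
  rewrite Rmax_left.
  - rewrite Hq, sqrt_pow2, Rmin_right by (apply Hw || assumption). reflexivity.
  - destruct (Req_dec r r0) as [->|Hne].
    + rewrite Hq0. lra.
    + apply Rlt_le, (flow_floor x q w); auto. lra.
Qed.

End Truncation.

(** * Existence, uniqueness and sign of the flow *)

Lemma speed_floor_exists Rm : r0 < Rm -> exists c, 0 < c /\
  forall r x w, r0 <= r <= Rm -> Sref <= x <= Sref + y0 * (Rm - r0) ->
    0 <= w <= y0 -> w ^ 2 <= c * (r - r0) -> c < accel r x w.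
Proof.
  intros HRm. assert (H := y0_pos).
  apply accel_pos_small_w; [lra | | lra].
  assert (0 < y0 * (Rm - r0)) by (apply Rmult_lt_0_compat; lra). lra.
Qed.

Lemma flow_exists Rm q0 : r0 < Rm -> 0 <= q0 <= y0 ^ 2 ->
  exists x q w, flow Rm x q w /\ q r0 = q0 /\ admissible y0 w /\
    forall r, r0 <= r <= Rm -> q r = w r ^ 2 /\ (r0 < r -> 0 < w r < x r / r).
Proof.
  intros HRm Hq0. assert (Hy0 := y0_pos).
  destruct (speed_floor_exists Rm HRm) as [c [Hc HcF]].
  destruct (speed_map_contracts Rm q0 c HRm Hc) as [K [HK Hcon]].
  destruct (volterra_exists r0 Rm y0 K (speed_map Rm q0 c)) as [u [Hu Hfix]];
    [lra .. | | |].
  - now apply speed_map_admissible.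
  - intros. now apply Hcon.
  - exists (reach u), (speed2 Rm q0 u), u.
    split; [apply flow_reach_speed2; [assumption | apply Hu] |].
    split; [apply speed2_r0 | split; [assumption |]].
    now apply (speed_map_fixed_flow Rm q0 c).
Qed.

Lemma flow_unique b x q w x' q' w' : r0 < b ->
  flow b x q w -> flow b x' q' w' -> admissible y0 w -> admissible y0 w' ->
  q' r0 = q r0 -> q r0 <= y0 ^ 2 ->
  (forall r, r0 <= r <= b -> q r = w r ^ 2) ->
  (forall r, r0 <= r <= b -> q' r = w' r ^ 2) ->
  forall r, r0 <= r <= b -> x r = x' r /\ w r = w' r.
Proof.
  intros Hb Hf Hf' Hw Hw' Hq0 Hq0' Hq Hq'. assert (Hy0 := y0_pos).
  assert (Hq00 : 0 <= q r0 <= y0 ^ 2).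
  { split; [| assumption]. rewrite Hq by lra. apply pow2_ge_0. }
  destruct (speed_floor_exists b Hb) as [c [Hc HcF]].
  destruct (speed_map_contracts b (q r0) c Hb Hc) as [K [HK Hcon]].
  assert (Heq : forall r, r0 <= r <= b -> w r = w' r).
  { apply (volterra_unique r0 b y0 K (speed_map b (q r0) c)); auto; try lra.
    - apply (flow_speed_map_fixed b (q r0) c Hb Hq00 HcF x q); auto.
    - apply (flow_speed_map_fixed b (q r0) c Hb Hq00 HcF x' q'); auto. }
  intros r Hr. split; [| now apply Heq].
  destruct (flow_eq_reach b (q r0) Hb x q w Hf (proj1 Hw) eq_refl r Hr) as [-> _].
  destruct (flow_eq_reach b (q r0) Hb x' q' w' Hf' (proj1 Hw') Hq0 r Hr) as [-> _].
  unfold reach. f_equal. apply RInt_ext.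
  intros s Hs. rewrite Rmin_left, Rmax_right in Hs by lra. apply Heq. lra.
Qed.

(** The case [r = b] matters: a shell is known to have positive density only in its interior, and
    this yields it at the outer radius. *)
Lemma flow_speed_pos b x q w : r0 < b ->
  flow b x q w -> admissible y0 w -> q r0 <= y0 ^ 2 ->
  (forall r, r0 <= r <= b -> q r = w r ^ 2) ->
  forall r, r0 < r <= b -> 0 < w r.
Proof.
  intros Hb Hf Hw Hq0 Hq r Hr.
  assert (Hq00 : 0 <= q r0 <= y0 ^ 2).
  { split; [| assumption]. rewrite Hq by lra. apply pow2_ge_0. }
  destruct (speed_floor_exists b Hb) as [c [Hc HcF]].
  assert (H := flow_floor b (q r0) c Hb Hq00 HcF x q w Hf Hw eq_refl Hq r Hr).
  rewrite Hq in H by lra.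
  assert (0 < c * (r - r0)) by (apply Rmult_lt_0_compat; lra).
  assert (Hwr := proj2 Hw r).
  destruct (Req_dec (w r) 0) as [He|]; [rewrite He in H; lra | lra].
Qed.

Lemma flow_restrict b b' x q w : b' <= b -> flow b x q w -> flow b' x q w.
Proof. intros Hb [H0 H]. split; [assumption | intros; apply H; lra]. Qed.

Lemma flow_speed_lt_ratio b x q w :
  flow b x q w -> q r0 <= y0 ^ 2 ->
  (forall r, r0 <= r <= b -> q r = w r ^ 2) ->
  (forall r, r0 < r <= b -> 0 < w r) ->
  forall r, r0 < r <= b -> w r < x r / r.
Proof.
  intros Hf Hq0 Hq Hw r Hr.
  assert (Hratio : forall t, r0 < t <= b -> 0 < x t / t).
  { intros t Ht. assert (Sref < x t) by (apply (flow_x_gt b x q w); auto; intros; apply Hw; lra).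
    apply Rdiv_lt_0_compat; lra. }
  assert (H : q r < (x r / r) ^ 2).
  { apply (flow_upper b x q w); auto.
    intros t Ht Hle. rewrite Hq in Hle by lra.
    specialize (Hw t Ht). specialize (Hratio t Ht). nra. }
  rewrite Hq in H by lra. specialize (Hratio r Hr). nra.
Qed.

End Field_equation.

(** * Seth shells *)

(** The function may vanish at [a], as the radial pressure does at [r0]; hence positivity just right
    of [a] is a separate hypothesis. The zero is the supremum of the [t] with [f > 0] on
    [(a, t)]. *)
Lemma first_zero (f : R -> R) (a b : R) :
  (forall t, a <= t <= b -> continuous f t) ->
  (exists del, 0 < del /\ forall t, a < t < a + del -> 0 < f t) ->
  (exists c, a < c <= b /\ f c <= 0) ->
  exists m, a < m <= b /\ f m = 0 /\ forall t, a < t < m -> 0 < f t.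
Proof.
  intros Hf [del [Hdel Hpos]] [c [Hc Hfc]].
  set (E := fun t => a <= t <= c /\ forall s, a < s < t -> 0 < f s).
  destruct (completeness E) as [m [Hub Hlub]].
  - exists c. intros t [Ht _]. lra.
  - exists a. split; [lra | intros; lra].
  - assert (Hmc : m <= c) by (apply Hlub; intros t [Ht _]; lra).
    assert (Ham : a < m).
    { apply Rlt_le_trans with (Rmin c (a + del)).
      - apply Rmin_glb_lt; lra.
      - apply Hub. split.
        + split; [apply Rmin_glb; lra | apply Rmin_l].
        + intros s Hs. apply Hpos. assert (H := Rmin_r c (a + del)). lra. }
    assert (Hleft : forall t, a < t < m -> 0 < f t).
    { intros t Ht. apply Rnot_le_lt. intros Hft.
      assert (m <= t); [| lra].
      apply Hlub. intros s [Hs Hs']. apply Rnot_lt_le. intros Hlt.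
      specialize (Hs' t ltac:(lra)). lra. }
    exists m. split; [lra | split; [| assumption]].
    assert (Hcm := Hf m ltac:(lra)).
    destruct (Rtotal_order (f m) 0) as [Hneg | [Hz | Hp]]; [| assumption |].
    + exfalso.
      destruct (proj1 (filterlim_locally f (f m)) Hcm (mkposreal (- f m) ltac:(lra)))
        as [d Hd].
      set (t := Rmax ((a + m) / 2) (m - d / 2)).
      assert (Hd0 := cond_pos d).
      assert (Ht : (a + m) / 2 <= t /\ m - d / 2 <= t /\ t < m).
      { unfold t. split; [apply Rmax_l | split; [apply Rmax_r |]].
        apply Rmax_lub_lt; lra. }
      assert (Hb : Rabs (f t - f m) < - f m).
      { apply (Hd t). change (Rabs (t - m) < d). apply Rabs_def1; lra. }
      apply Rabs_def2 in Hb. specialize (Hleft t ltac:(lra)). lra.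
    + exfalso.
      assert (Hmc' : m < c) by (destruct (Req_dec m c) as [->|]; lra).
      destruct (proj1 (filterlim_locally f (f m)) Hcm (mkposreal (f m) Hp)) as [d Hd].
      assert (Hd0 := cond_pos d).
      assert (Hle : Rmin c (m + d / 2) <= m); [| revert Hle; apply Rmin_case; lra].
      apply Hub. split.
      * split; [apply Rmin_glb; lra | apply Rmin_l].
      * intros s Hs. assert (Hs' := Rmin_r c (m + d / 2)).
        destruct (Rlt_le_dec s m) as [|Hms]; [apply Hleft; lra |].
        assert (Hb : Rabs (f s - f m) < f m).
        { apply (Hd s). change (Rabs (s - m) < d). apply Rabs_def1; lra. }
        apply Rabs_def2 in Hb. lra.
Qed.

Lemma Rpower_cube_root (x : R) : 0 < x -> Rpower (x ^ 3) (1 / 3) = x.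
Proof.
  intros Hx. rewrite <- (Rpower_pow 3 x Hx), Rpower_mult.
  replace (INR 3 * (1 / 3)) with 1 by (simpl; field). now apply Rpower_1.
Qed.

Lemma cube_Rpower_root (z : R) : 0 < z -> Rpower z (1 / 3) ^ 3 = z.
Proof.
  intros Hz. rewrite <- Rpower_pow, Rpower_mult by apply exp_pos.
  replace (1 / 3 * INR 3) with 1 by (simpl; field). now apply Rpower_1.
Qed.

Lemma Rpower_cube_2_3 (x : R) : 0 < x -> Rpower (x ^ 3) (2 / 3) = x ^ 2.
Proof.
  intros Hx. rewrite <- (Rpower_pow 3 x Hx), Rpower_mult.
  replace (INR 3 * (2 / 3)) with (INR 2) by (simpl; field). now apply Rpower_pow.
Qed.

Lemma Rpower_cube_m4_3 (x : R) : 0 < x -> Rpower (x ^ 3) (- 4 / 3) = / x ^ 4.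
Proof.
  intros Hx. rewrite <- (Rpower_pow 3 x Hx), Rpower_mult.
  replace (INR 3 * (- 4 / 3)) with (- INR 4) by (simpl; field).
  now rewrite Rpower_Ropp, Rpower_pow.
Qed.

Lemma locally_open_interval (a b r : R) (P : R -> Prop) :
  a < r < b -> (forall t, a < t < b -> P t) -> locally r P.
Proof.
  intros Hr HP.
  assert (Hd : 0 < Rmin (r - a) (b - r)) by (apply Rmin_pos; lra).
  exists (mkposreal _ Hd). intros t Ht.
  change (Rabs (t - r) < Rmin (r - a) (b - r)) in Ht.
  assert (H1 := Rmin_l (r - a) (b - r)). assert (H2 := Rmin_r (r - a) (b - r)).
  apply Rabs_def2 in Ht. apply HP. lra.
Qed.

Lemma C1_on_open_interval_intro (f g dg : R -> R) (a b : R) :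
  (forall r, a < r < b -> f r = g r) ->
  (forall r, a < r < b -> is_derive g r (dg r)) ->
  (forall r, a < r < b -> continuous dg r) ->
  C1_on_open_interval a b f /\ (forall r, a < r < b -> Derive f r = dg r).
Proof.
  intros Hfg Hg Hdg.
  assert (Hf : forall r, a < r < b -> is_derive f r (dg r)).
  { intros r Hr. apply (is_derive_ext_loc g); [| now apply Hg].
    apply (locally_open_interval a b); [assumption |].
    intros t Ht. symmetry. now apply Hfg. }
  assert (HD : forall r, a < r < b -> Derive f r = dg r)
    by (intros; now apply is_derive_unique, Hf).
  split; [| assumption].
  intros r Hr. split; [eexists; now apply Hf |].
  apply (continuous_ext_loc _ dg); [| now apply Hdg].
  apply (locally_open_interval a b); [assumption |].
  intros t Ht. symmetry. now apply HD.
Qed.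

(** The difference has zero derivative inside, so its value 0 at the midpoint propagates to both
    ends. *)
Lemma continuous_eq_closed (f g : R -> R) (a b : R) :
  a < b ->
  (forall r, a <= r <= b -> continuous f r) ->
  (forall r, a <= r <= b -> continuous g r) ->
  (forall r, a < r < b -> f r = g r) ->
  forall r, a <= r <= b -> f r = g r.
Proof.
  intros Hab Hf Hg Heq.
  set (h := fun s => f s - g s).
  assert (Hc : forall r, a <= r <= b -> continuous h r)
    by (intros; apply (continuous_minus f g); auto).
  assert (Hd : forall r, a < r < b -> is_derive h r 0).
  { intros r Hr. apply (is_derive_ext_loc (fun _ => 0)).
    - apply (locally_open_interval a b); [assumption |].
      intros t Ht. change (0 = f t - g t). rewrite Heq by assumption. ring.
    - apply (is_derive_const 0). }
  assert (Hm : h ((a + b) / 2) = 0) by (unfold h; rewrite Heq by lra; ring).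
  assert (H1 : h b = h ((a + b) / 2)).
  { apply derive_zero_const; [lra | |]; intros; [apply Hc | apply Hd]; lra. }
  assert (H2 : h ((a + b) / 2) = h a).
  { apply derive_zero_const; [lra | |]; intros; [apply Hc | apply Hd]; lra. }
  intros r Hr. destruct (Req_dec r a) as [->|]; [unfold h in *; lra |].
  destruct (Req_dec r b) as [->|]; [unfold h in *; lra |].
  apply Heq. lra.
Qed.

(** * The Seth coefficients and pressures *)

Section Seth.

Variables lam mu Kref Sref r0 : R.
Hypothesis (hlam : 0 < lam) (hmu : 0 < mu) (hK : 0 < Kref) (hS : 0 < Sref)
  (hr0 : 0 < r0).

(** These four coefficients come from multiplying the equilibrium equation by [2 / (lam + 2 * mu)],
    the inverse of the coefficient of [w ^ 2] in the radial pressure. *)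
Let al := 4 * (lam + mu) / (lam + 2 * mu).
Let be := 4 * lam / (lam + 2 * mu).
Let ga := 4 * mu / (lam + 2 * mu).
Let ka := 8 * PI * Kref ^ 2 / (3 * (lam + 2 * mu)).

Lemma be_pos : 0 < be.
Proof. apply Rdiv_lt_0_compat; lra. Qed.

Lemma ga_pos : 0 < ga.
Proof. apply Rdiv_lt_0_compat; lra. Qed.

Lemma ka_pos : 0 < ka.
Proof.
  assert (H := PI_RGT_0).
  apply Rdiv_lt_0_compat; [| lra].
  apply Rmult_lt_0_compat; [lra | now apply pow_lt].
Qed.

Lemma al_split : al = be + ga.
Proof. unfold al, be, ga. field. lra. Qed.

Local Notation sflow := (flow al be ga ka Sref r0).
Local Notation saccel := (accel al be ga ka Sref).

Definition prad_of (y q : R) : R := lam * y ^ 2 + (lam + 2 * mu) / 2 * q - seth_p0 lam mu.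
Definition ptan_of (y q : R) : R := (lam + mu) * y ^ 2 + lam / 2 * q - seth_p0 lam mu.

Definition drad (r x w : R) : R :=
  2 * lam * (x / r) * ((w - x / r) / r) + (lam + 2 * mu) / 2 * saccel r x w.

(** Used in both directions: to verify equilibrium of a constructed shell, and to identify the
    pressure derivative of a given one. *)
Lemma drad_equilibrium r x w : 0 < r ->
  drad r x w + 2 / r * (prad_of (x / r) (w ^ 2) - ptan_of (x / r) (w ^ 2))
  + Kref * w * (x / r) ^ 2 * (4 * PI * Kref * (x ^ 3 - Sref ^ 3) / 3 / r ^ 2) = 0.
Proof.
  intros Hr. unfold drad, prad_of, ptan_of, accel, al, be, ga, ka. field. lra.
Qed.

(** No mass is enclosed at [r0], so only the pressure anisotropy remains; its sign decides whether
    the pressure can rise from 0. *)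
Lemma drad_start w : drad r0 Sref w = 2 * mu / r0 * ((Sref / r0) ^ 2 - w ^ 2).
Proof.
  unfold drad, accel, al, be, ga, ka. field. lra.
Qed.

Lemma is_derive_prad_of b x q w r : sflow b x q w -> r0 <= r <= b ->
  is_derive (fun r => prad_of (x r / r) (q r)) r (drad r (x r) (w r)).
Proof.
  intros [_ Hf] Hr. destruct (Hf r Hr) as [Hx Hq].
  unfold prad_of. auto_derive.
  - split; [now exists (w r) | split; [lra |]].
    split; [now exists (saccel r (x r) (w r)) | exact I].
  - rewrite (is_derive_unique (fun s : R => x s) _ _ Hx).
    rewrite (is_derive_unique (fun s : R => q s) _ _ Hq).
    unfold drad. field. lra.
Qed.

(** The state [y = w = 1] is stress-free and the radial pressure increases in both squares, so
    [w < y <= 1] would make it negative. *)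
Lemma ratio_gt_1 y w : 0 <= w < y -> 0 <= prad_of y (w ^ 2) -> 1 < y.
Proof.
  intros Hw Hp. unfold prad_of, seth_p0 in Hp.
  apply Rnot_le_lt. intros Hy.
  assert (w ^ 2 < y ^ 2) by nra. assert (y ^ 2 <= 1) by nra. nra.
Qed.

Lemma seth_pressures (y w : R) : 0 < y ->
  seth_prad lam mu (w * y ^ 2) (y ^ 3) = prad_of y (w ^ 2) /\
  seth_ptan lam mu (w * y ^ 2) (y ^ 3) = ptan_of y (w ^ 2).
Proof.
  intros Hy. unfold seth_prad, seth_ptan, prad_of, ptan_of.
  rewrite Rpower_cube_2_3, Rpower_cube_m4_3 by assumption.
  split; field; lra.
Qed.

(** * From a flow to a shell *)

Definition on_shell (r1 : R) (f : R -> R) (r : R) : R :=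
  if Rle_dec r0 r then if Rle_dec r r1 then f r else 0 else 0.

Lemma on_shell_in r1 f r : r0 <= r <= r1 -> on_shell r1 f r = f r.
Proof. intros. unfold on_shell. destruct (Rle_dec r0 r), (Rle_dec r r1); lra. Qed.

Lemma on_shell_out r1 f r : ~ (r0 <= r <= r1) -> on_shell r1 f r = 0.
Proof. intros. unfold on_shell. destruct (Rle_dec r0 r), (Rle_dec r r1); lra. Qed.

Lemma flow_seth_shell r1 x q w :
  r0 < r1 -> sflow r1 x q w -> (forall t, continuous w t) ->
  (forall r, r0 <= r <= r1 -> q r = w r ^ 2) ->
  0 <= w r0 -> (forall r, r0 < r <= r1 -> 0 < w r < x r / r) ->
  prad_of (Sref / r0) (q r0) = 0 -> prad_of (x r1 / r1) (q r1) = 0 ->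
  (forall r, r0 < r < r1 -> 0 < prad_of (x r / r) (q r)) ->
  seth_shell lam mu Kref Sref r0 r1
    (on_shell r1 (fun r => Kref * w r * (x r / r) ^ 2))
    (on_shell r1 (fun r => prad_of (x r / r) (q r)))
    (on_shell r1 (fun r => ptan_of (x r / r) (q r))).
Proof.
  intros Hr1 Hf Hw Hq Hw0 Hwy Hp0 Hp1 Hpos.
  assert (Hx0 := proj1 Hf).
  assert (HxS : forall r, r0 <= r <= r1 -> Sref <= x r).
  { intros r Hr. destruct (Req_dec r r0) as [->|]; [lra |].
    apply Rlt_le, (flow_x_gt al be ga ka Sref r0 r1 x q w); auto;
      [intros; apply Hwy |]; lra. }
  assert (Hy : forall r, r0 <= r <= r1 -> 0 < x r / r).
  { intros r Hr. specialize (HxS r Hr). apply Rdiv_lt_0_compat; lra. }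
  assert (Hxc : forall r, r0 <= r <= r1 -> continuous x r).
  { intros r Hr. apply (ex_derive_continuous x). eexists. now apply Hf. }
  assert (Hqc : forall r, r0 <= r <= r1 -> continuous q r).
  { intros r Hr. apply (ex_derive_continuous q). eexists. now apply Hf. }
  assert (Hac : forall r, r0 <= r <= r1 ->
            continuous (fun s => saccel s (x s) (w s)) r).
  { intros r Hr. apply (continuous_accel al be ga ka Sref (fun s => s)); auto.
    - lra.
    - apply continuous_id. }
  assert (Hrho0 : forall r, r0 <= r <= r1 -> 0 <= Kref * w r * (x r / r) ^ 2).
  { intros r Hr. specialize (Hy r Hr).
    assert (0 <= w r) by (destruct (Req_dec r r0) as [->|];
      [assumption | apply Rlt_le, Hwy; lra]).
    apply Rmult_le_pos; [apply Rmult_le_pos; lra | apply pow2_ge_0]. }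
  assert (Hrho : forall r, r0 < r <= r1 -> 0 < Kref * w r * (x r / r) ^ 2).
  { intros r Hr. specialize (Hy r ltac:(lra)). specialize (Hwy r Hr).
    apply Rmult_lt_0_compat; [apply Rmult_lt_0_compat; lra | now apply pow_lt]. }
  assert (Hmass : forall r, r0 <= r <= r1 ->
    mass r0 (on_shell r1 (fun r => Kref * w r * (x r / r) ^ 2)) r
    = 4 * PI * Kref * (x r ^ 3 - Sref ^ 3) / 3).
  { intros r Hr. unfold mass.
    (* The integrand is [Kref * x ^ 2 * x'], an exact derivative. *)
    rewrite (is_RInt_unique _ r0 r (minus (Kref * x r ^ 3 / 3) (Kref * x r0 ^ 3 / 3))).
    - rewrite Hx0. unfold minus, plus, opp; simpl. field.
    - apply (is_RInt_ext (fun s => Kref * x s ^ 2 * w s)).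
      + intros s Hs. rewrite Rmin_left, Rmax_right in Hs by lra.
        rewrite on_shell_in by lra.
        match goal with |- ?a = ?b => change (@eq R a b) end. field. lra.
      + apply (is_RInt_derive (fun s => Kref * x s ^ 3 / 3)).
        * intros s Hs. rewrite Rmin_left, Rmax_right in Hs by lra.
          destruct (proj2 Hf s ltac:(lra)) as [Hxs _].
          auto_derive; [now exists (w s) |].
          rewrite (is_derive_unique (fun s : R => x s) _ _ Hxs). field.
        * intros s Hs. rewrite Rmin_left, Rmax_right in Hs by lra.
          assert (Hxs := Hxc s ltac:(lra)). contin. }
  (* Only continuity of [w] is known, so the density is differentiated through [sqrt (q r)], with
     [q] positive inside. *)
  destruct (C1_on_open_interval_intro
    (on_shell r1 (fun r => Kref * w r * (x r / r) ^ 2))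
    (fun r => Kref * sqrt (q r) * (x r / r) ^ 2)
    (fun r => Kref * (saccel r (x r) (w r) / (2 * w r)) * (x r / r) ^ 2
       + Kref * w r * (2 * (x r / r) * ((w r - x r / r) / r))) r0 r1)
    as [C1rho _].
  { intros r Hr. rewrite on_shell_in, Hq, sqrt_pow2 by (try apply Rlt_le, Hwy; lra).
    reflexivity. }
  { intros r Hr. destruct (proj2 Hf r ltac:(lra)) as [Hxr Hqr].
    assert (Hwr := Hwy r ltac:(lra)).
    auto_derive.
    - split; [now exists (saccel r (x r) (w r)) |].
      split; [rewrite Hq by lra; apply pow_lt; lra |].
      split; [now exists (w r) | split; [lra | exact I]].
    - rewrite (is_derive_unique (fun s : R => x s) _ _ Hxr).
      rewrite (is_derive_unique (fun s : R => q s) _ _ Hqr).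
      rewrite Hq, sqrt_pow2 by lra. field. lra. }
  { intros r Hr. assert (Hwr := Hwy r ltac:(lra)).
    assert (Hxr := Hxc r ltac:(lra)). assert (Har := Hac r ltac:(lra)).
    contin; lra. }
  destruct (C1_on_open_interval_intro
    (on_shell r1 (fun r => prad_of (x r / r) (q r)))
    (fun r => prad_of (x r / r) (q r)) (fun r => drad r (x r) (w r)) r0 r1)
    as [C1rad Hrad].
  { intros r Hr. now rewrite on_shell_in by lra. }
  { intros r Hr. apply (is_derive_prad_of r1 x q w); [assumption | lra]. }
  { intros r Hr.
    assert (Hxr := Hxc r ltac:(lra)). assert (Har := Hac r ltac:(lra)).
    unfold drad. contin; lra. }
  destruct (C1_on_open_interval_intro
    (on_shell r1 (fun r => ptan_of (x r / r) (q r)))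
    (fun r => ptan_of (x r / r) (q r))
    (fun r => (lam + mu) * (2 * (x r / r) * ((w r - x r / r) / r))
       + lam / 2 * saccel r (x r) (w r)) r0 r1)
    as [C1tan _].
  { intros r Hr. now rewrite on_shell_in by lra. }
  { intros r Hr. destruct (proj2 Hf r ltac:(lra)) as [Hxr Hqr].
    unfold ptan_of. auto_derive.
    - split; [now exists (w r) | split; [lra |]].
      split; [now exists (saccel r (x r) (w r)) | exact I].
    - rewrite (is_derive_unique (fun s : R => x s) _ _ Hxr).
      rewrite (is_derive_unique (fun s : R => q s) _ _ Hqr). field. lra. }
  { intros r Hr.
    assert (Hxr := Hxc r ltac:(lra)). assert (Har := Hac r ltac:(lra)).
    contin; lra. }
  split; [constructor |].
  - assumption.
  - assumption.
  - intros r Hr.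
    destruct (Rle_dec r0 r) as [H0|H0]; [destruct (Rle_dec r r1) as [H1|H1] |].
    + rewrite on_shell_in by lra. apply Hrho0. lra.
    + rewrite on_shell_out by lra. lra.
    + rewrite on_shell_out by lra. lra.
  - split; intros r Hr.
    + destruct Hr as [d Hd]. assert (Hd0 := cond_pos d).
      (* Density vanishes off the closed interval, so a whole ball of positive density lies in it;
         points on both sides of [r] then give strict inequalities. *)
      assert (Hin : forall t, Rabs (t - r) < d -> r0 <= t <= r1).
      { intros t Ht. apply Hd in Ht. destruct Ht as [_ Ht].
        destruct (Rle_dec r0 t); [destruct (Rle_dec t r1); [lra |] |];
          rewrite on_shell_out in Ht; lra. }
      assert (H1 := Hin (r - d / 2) ltac:(apply Rabs_def1; lra)).
      assert (H2 := Hin (r + d / 2) ltac:(apply Rabs_def1; lra)). lra.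
    + destruct (locally_open_interval r0 r1 r
        (fun r => 0 < r /\ 0 < on_shell r1 (fun r => Kref * w r * (x r / r) ^ 2) r) Hr)
        as [d Hd].
      * intros t Ht. split; [lra |]. rewrite on_shell_in by lra. apply Hrho. lra.
      * exists d. exact Hd.
  - split; [| split]; assumption.
  - repeat split.
    + apply (continuous_C0_on _ (fun r => Kref * w r * (x r / r) ^ 2)).
      * intros. now rewrite on_shell_in.
      * intros r Hr. assert (Hxr := Hxc r Hr). contin; lra.
    + apply (continuous_C0_on _ (fun r => prad_of (x r / r) (q r))).
      * intros. now rewrite on_shell_in.
      * intros r Hr. assert (Hxr := Hxc r Hr). assert (Hqr := Hqc r Hr).
        unfold prad_of. contin; lra.
    + apply (continuous_C0_on _ (fun r => ptan_of (x r / r) (q r))).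
      * intros. now rewrite on_shell_in.
      * intros r Hr. assert (Hxr := Hxc r Hr). assert (Hqr := Hqc r Hr).
        unfold ptan_of. contin; lra.
  - intros r Hr. rewrite Hrad, Hmass, !on_shell_in, !Hq by lra.
    apply drad_equilibrium. lra.
  - intros r Hr. rewrite !on_shell_in by lra.
    specialize (Hpos r Hr). split; [assumption |].
    specialize (Hwy r ltac:(lra)). rewrite Hq in * by lra.
    unfold prad_of, ptan_of in *. assert (w r ^ 2 < (x r / r) ^ 2) by nra. nra.
  - rewrite !on_shell_in, Hx0 by lra. split; assumption.
  - intros r _ Hr. rewrite !on_shell_out by assumption. auto.
  - intros r Hr. unfold shell_delta, shell_eta.
    rewrite Hmass, !on_shell_in, Hq by lra.
    assert (Hpi := PI_RGT_0).
    replace ((Sref / r) ^ 3 + 4 * PI * Kref * (x r ^ 3 - Sref ^ 3) / 3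
       / (4 * PI / 3 * Kref * r ^ 3)) with ((x r / r) ^ 3) by (field; lra).
    replace (Kref * w r * (x r / r) ^ 2 / Kref) with (w r * (x r / r) ^ 2)
      by (field; lra).
    destruct (seth_pressures (x r / r) (w r)) as [-> ->]; [apply Hy; lra |].
    split; reflexivity.
Qed.

Lemma seth_shell_exists : 1 < Sref / r0 ->
  lam * (Sref / r0) ^ 2 <= seth_p0 lam mu ->
  exists r1 rho prad ptan, seth_shell lam mu Kref Sref r0 r1 rho prad ptan.
Proof.
  intros Hy0 Hp0. set (y0 := Sref / r0) in *.
  set (q0 := 2 / (lam + 2 * mu) * (seth_p0 lam mu - lam * y0 ^ 2)).
  assert (Hrad0 : prad_of y0 q0 = 0) by (unfold prad_of, q0; field; lra).
  assert (Hq0 : 0 <= q0 < y0 ^ 2).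
  { split.
    - apply Rmult_le_pos; [apply Rlt_le, Rdiv_lt_0_compat |]; lra.
    - unfold prad_of, seth_p0 in Hrad0. assert (1 < y0 ^ 2) by nra. nra. }
  (* The horizon is fixed before solving: positive pressure cannot persist up to it. *)
  destruct (flow_bounded al be ga ka Sref r0) as [Rm [HRm Hbdd]];
    auto using be_pos, ga_pos, ka_pos, al_split.
  destruct (flow_exists al be ga ka Sref r0 be_pos ga_pos al_split ka_pos hS hr0
    Rm q0 HRm) as [x [q [w [Hf [Hqr0 [Hw Hqw]]]]]]; [fold y0; lra |].
  assert (Hder := fun r => is_derive_prad_of Rm x q w r Hf).
  destruct (first_zero (fun r => prad_of (x r / r) (q r)) r0 Rm) as [r1 [Hr1 [Hz Hpos]]].
  - intros t Ht. apply (ex_derive_continuous (fun r => prad_of (x r / r) (q r))).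
    eexists. now apply Hder.
  - destruct (is_derive_pos_near (fun r => prad_of (x r / r) (q r)) r0
      (drad r0 (x r0) (w r0))) as [d [Hd [_ Hright]]].
    + apply Hder. lra.
    + rewrite (proj1 Hf), drad_start. fold y0.
      destruct (Hqw r0 ltac:(lra)) as [<- _]. rewrite Hqr0.
      apply Rmult_lt_0_compat; [apply Rdiv_lt_0_compat |]; lra.
    + exists d. split; [assumption |].
      intros t Ht. specialize (Hright t Ht).
      rewrite (proj1 Hf), Hqr0 in Hright. fold y0 in Hright. lra.
  - destruct (Rle_lt_dec (prad_of (x Rm / Rm) (q Rm)) 0) as [|HposRm];
      [exists Rm; lra |].
    (* Otherwise [x / r > 1] throughout, and [flow_bounded] with [b = Rm] gives [Rm < Rm]. *)
    assert (Hc : ~ forall r, r0 < r <= Rm -> 0 < prad_of (x r / r) (q r)).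
    { intros Hpos. apply (Rlt_irrefl Rm).
      assert (Hwy : forall t, r0 < t <= Rm -> 0 < w t < x t / t)
        by (intros t Ht; apply Hqw; lra).
      apply (Hbdd Rm x q w); [lra | assumption |].
      intros r Hr. destruct (Hqw r Hr) as [Hq _]. fold y0.
      assert (Hle : x r / r <= y0).
      { unfold y0. rewrite <- (proj1 Hf).
        apply (flow_ratio_decr al be ga ka Sref r0 hr0 Rm x q w); try lra; auto.
        intros t Ht. apply Rlt_le, Hwy. lra. }
      assert (Hge : 1 < x r / r).
      { destruct (Req_dec r r0) as [->|]; [rewrite (proj1 Hf); assumption |].
        apply (ratio_gt_1 _ (w r)).
        - specialize (Hwy r ltac:(lra)). lra.
        - rewrite <- Hq. apply Rlt_le, Hpos. lra. }
      assert (Hwr := proj2 Hw r). fold y0 in Hwr.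
      repeat split; try lra; rewrite Hq; [apply pow2_ge_0 | apply pow_incr; lra]. }
    apply not_all_ex_not in Hc. destruct Hc as [c Hc].
    exists c. split; [| apply Rnot_lt_le]; tauto.
  - exists r1.
    do 3 eexists.
    apply (flow_seth_shell r1 x q w); try lra.
    + apply (flow_restrict al be ga ka Sref r0 Rm); [lra | assumption].
    + apply Hw.
    + intros r Hr. apply Hqw. lra.
    + apply Hw.
    + intros r Hr. apply Hqw; lra.
    + rewrite Hqr0. exact Hrad0.
    + assumption.
Qed.

(** * From a shell to a flow *)

Lemma cube_root_derive (z : R -> R) (r dz : R) :
  is_derive z r dz -> 0 < z r ->
  is_derive (fun r => Rpower (z r) (1 / 3)) r (dz / (3 * Rpower (z r) (1 / 3) ^ 2)).
Proof.
  intros Hz Hpos. unfold Rpower. auto_derive.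
  - split; [now exists dz | split; [assumption | exact I]].
  - rewrite (is_derive_unique (fun s : R => z s) _ _ Hz).
    assert (H := cube_Rpower_root (z r) Hpos). unfold Rpower in H.
    assert (He := exp_pos (1 / 3 * ln (z r))).
    set (e := exp (1 / 3 * ln (z r))) in *.
    rewrite <- H. field. lra.
Qed.

(** A flow has two-sided derivatives up to the endpoints, whereas [w ^ 2] is differentiable only
    inside the shell. So [q] is defined as an integral of [accel], and equilibrium shows that
    [q - w ^ 2] is constant. *)
Lemma seth_shell_flow_raw r1 rho prad ptan :
  seth_shell lam mu Kref Sref r0 r1 rho prad ptan ->
  exists x q w, sflow r1 x q w /\
    (forall t, continuous w t) /\ (forall t, w t = w (clip r0 r1 t)) /\
    (forall r, r0 <= r <= r1 ->
       0 <= w r /\ 0 < x r /\ q r = w r ^ 2 /\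
       rho r = Kref * w r * (x r / r) ^ 2 /\
       prad r = prad_of (x r / r) (w r ^ 2) /\
       ptan r = ptan_of (x r / r) (w r ^ 2) /\
       mass r0 rho r = 4 * PI * Kref * (x r ^ 3 - Sref ^ 3) / 3) /\
    (forall r, r0 < r < r1 -> 0 < w r).
Proof.
  intros [Hsh Hmat].
  assert (Hr1 := shell_r0_lt_r1 _ _ _ _ _ Hsh).
  destruct (shell_C0 _ _ _ _ _ Hsh) as [Crho [Cprad Cptan]].
  assert (Hpi := PI_RGT_0).
  assert (Hclip : forall t, r0 <= clip r0 r1 t <= r1) by (intros; apply clip_bounds; lra).
  (* The density itself may jump at the endpoints; this extension does not. *)
  set (R' := fun s => rho (clip r0 r1 s)).
  assert (HR'c : forall s, continuous R' s)
    by (apply continuous_on_comp_clip; [lra | assumption]).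
  assert (HR'0 : forall s, 0 <= R' s).
  { intros s. apply (shell_rho_nonneg _ _ _ _ _ Hsh). specialize (Hclip s). lra. }
  assert (HR2c : forall s, continuous (fun s => R' s * s ^ 2) s) by (intros; contin).
  set (z := fun r => Sref ^ 3 + 3 / Kref * RInt (fun s => R' s * s ^ 2) r0 r).
  assert (HS3 : 0 < Sref ^ 3) by now apply pow_lt.
  assert (Hmz : forall r, r0 <= r <= r1 ->
            mass r0 rho r = 4 * PI * Kref * (z r - Sref ^ 3) / 3).
  { intros r Hr. unfold mass, z.
    rewrite (RInt_ext (fun s => rho s * s ^ 2) (fun s => R' s * s ^ 2)).
    - field. lra.
    - intros s Hs. rewrite Rmin_left, Rmax_right in Hs by lra.
      unfold R'. now rewrite clip_id by lra. }
  assert (Hz : forall r, r0 <= r -> 0 < z r).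
  { intros r Hr. unfold z.
    assert (0 <= RInt (fun s => R' s * s ^ 2) r0 r).
    { apply RInt_ge_0; [assumption | |].
      - apply (ex_RInt_continuous (fun s => R' s * s ^ 2)). auto.
      - intros s Hs. apply Rmult_le_pos; [apply HR'0 | apply pow2_ge_0]. }
    assert (0 < 3 / Kref) by (apply Rdiv_lt_0_compat; lra). nra. }
  assert (Hdz : forall r, is_derive z r (3 / Kref * (R' r * r ^ 2))).
  { intros r. unfold z.
    evar_last; [apply (is_derive_plus (fun _ => Sref ^ 3)
        (fun r => 3 / Kref * RInt (fun s => R' s * s ^ 2) r0 r));
      [apply is_derive_const |
       apply (is_derive_scal (RInt (fun s => R' s * s ^ 2) r0));
       now apply (is_derive_RInt_continuous (fun s => R' s * s ^ 2))] |].
    apply plus_zero_l. }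
  set (x := fun r => Rpower (z r) (1 / 3)).
  assert (Hx : forall r, 0 < x r) by (intros; apply exp_pos).
  assert (Hx3 : forall r, r0 <= r -> x r ^ 3 = z r).
  { intros r Hr. now apply cube_Rpower_root, Hz. }
  (* Solves [rho = Kref * w * (x / r) ^ 2]; constant outside the shell, so bounds on the shell hold
     everywhere. *)
  set (w := fun t => let s := clip r0 r1 t in rho s * s ^ 2 / (Kref * x s ^ 2)).
  assert (Hwclip : forall t, w t = w (clip r0 r1 t)).
  { intros t. unfold w. now rewrite (clip_id r0 r1 (clip r0 r1 t)). }
  assert (Hw : forall r, r0 <= r <= r1 -> w r = rho r * r ^ 2 / (Kref * x r ^ 2)).
  { intros r Hr. unfold w. now rewrite clip_id. }
  assert (Hdx : forall r, r0 <= r <= r1 -> is_derive x r (w r)).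
  { intros r Hr.
    evar_last; [apply (cube_root_derive z r _ (Hdz r)), Hz; lra |].
    rewrite Hw by assumption. unfold R'. rewrite clip_id by assumption.
    fold (x r). specialize (Hx r). field. lra. }
  assert (Hxc : forall r, r0 <= r <= r1 -> continuous x r).
  { intros r Hr. apply (ex_derive_continuous x). eexists. now apply Hdx. }
  assert (Hxcc : forall t, continuous (fun t => x (clip r0 r1 t)) t).
  { intros t. apply (continuous_comp (clip r0 r1) x); [apply continuous_clip |].
    now apply Hxc. }
  assert (Hcc := continuous_clip r0 r1).
  assert (Hwc : forall t, continuous w t).
  { intros t. unfold w. assert (HRt := HR'c t). unfold R' in HRt.
    assert (Hxt := Hxcc t). assert (Hct := Hcc t).
    apply (continuous_mult (fun t => rho (clip r0 r1 t) * clip r0 r1 t ^ 2)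
      (fun t => / (Kref * x (clip r0 r1 t) ^ 2))).
    - contin.
    - contin. specialize (Hx (clip r0 r1 t)).
      apply Rmult_integral_contrapositive_currified; [lra | apply pow_nonzero; lra]. }
  assert (Hw0 : forall r, r0 <= r <= r1 -> 0 <= w r).
  { intros r Hr. rewrite Hw by assumption.
    apply Rdiv_le_0_compat.
    - apply Rmult_le_pos; [apply (shell_rho_nonneg _ _ _ _ _ Hsh); lra | apply pow2_ge_0].
    - apply Rmult_lt_0_compat; [assumption | now apply pow_lt]. }
  assert (Hrho : forall r, r0 <= r <= r1 -> rho r = Kref * w r * (x r / r) ^ 2).
  { intros r Hr. rewrite Hw by assumption. specialize (Hx r). field. lra. }
  assert (Hwpos : forall r, r0 < r < r1 -> 0 < w r).
  { intros r Hr.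
    assert (Hin : 0 < r /\ 0 < rho r).
    { apply (interior_P1 (fun r => 0 < r /\ 0 < rho r)).
      now apply (proj2 (shell_Omega _ _ _ _ _ Hsh)). }
    rewrite Hw by lra. specialize (Hx r).
    apply Rdiv_lt_0_compat; apply Rmult_lt_0_compat; try lra; apply pow_lt; lra. }
  assert (Hpress : forall r, r0 < r < r1 ->
    prad r = prad_of (x r / r) (w r ^ 2) /\ ptan r = ptan_of (x r / r) (w r ^ 2)).
  { intros r Hr. destruct (Hmat r Hr) as [Hp Ht].
    assert (Hxr := Hx r).
    assert (Hy : 0 < x r / r) by (apply Rdiv_lt_0_compat; lra).
    destruct (seth_pressures (x r / r) (w r) Hy) as [H1 H2].
    rewrite <- H1, <- H2.
    assert (Hdelta : shell_delta Kref rho r = w r * (x r / r) ^ 2).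
    { unfold shell_delta. rewrite Hrho by lra. field. lra. }
    assert (Heta : shell_eta Kref Sref r0 rho r = (x r / r) ^ 3).
    { unfold shell_eta. rewrite Hmz, <- Hx3 by lra. field. lra. }
    rewrite <- Hdelta, <- Heta. now split. }
  set (x' := fun t => x (clip r0 r1 t)).
  set (q := fun r => w r0 ^ 2
    + RInt (fun s => saccel (clip r0 r1 s) (x' s) (w s)) r0 r).
  assert (Hac : forall t, continuous (fun s => saccel (clip r0 r1 s) (x' s) (w s)) t).
  { intros t. apply (continuous_accel al be ga ka Sref (clip r0 r1)); auto.
    specialize (Hclip t). lra. }
  assert (Hdq : forall r, r0 <= r <= r1 -> is_derive q r (saccel r (x r) (w r))).
  { intros r Hr. unfold q.
    evar_last; [apply (is_derive_plus (fun _ => w r0 ^ 2)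
        (RInt (fun s => saccel (clip r0 r1 s) (x' s) (w s)) r0));
      [apply is_derive_const |
       now apply (is_derive_RInt_continuous
         (fun s => saccel (clip r0 r1 s) (x' s) (w s)))] |].
    unfold x'. rewrite clip_id by assumption. apply plus_zero_l. }
  assert (Hq : forall r, r0 <= r <= r1 -> q r = w r ^ 2).
  { intros r Hr.
    set (h := fun s => q s - w s ^ 2).
    assert (Hh : h r = h r0).
    { apply derive_zero_const; [lra | |].
      - intros s Hs. apply (continuous_minus q (fun s => w s ^ 2)).
        + apply (ex_derive_continuous q). eexists. apply Hdq. lra.
        + assert (Hws := Hwc s). contin.
      - intros s Hs.
        assert (Hp : is_derive prad s (Derive prad s)).
        { apply Derive_correct. apply (shell_C1 _ _ _ _ _ Hsh). lra. }
        assert (Hxs := Hx s).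
        (* Here [w ^ 2] is expressed through the radial pressure, whose differentiability is
           given. *)
        assert (Hd : is_derive (fun s => q s - 2 / (lam + 2 * mu)
                  * (prad s + seth_p0 lam mu - lam * (x s / s) ^ 2)) s
           (saccel s (x s) (w s) - 2 / (lam + 2 * mu)
                  * (Derive prad s - 2 * lam * (x s / s) * ((w s - x s / s) / s)))).
        { assert (Hqs := Hdq s ltac:(lra)). assert (Hxd := Hdx s ltac:(lra)).
          auto_derive.
          - split; [now exists (saccel s (x s) (w s)) |].
            split; [now exists (Derive prad s) |].
            split; [now exists (w s) | split; [lra | exact I]].
          - rewrite (is_derive_unique (fun s : R => x s) _ _ Hxd).
            rewrite (is_derive_unique (fun s : R => q s) _ _ Hqs).
            rewrite (is_derive_unique (fun s : R => prad s) _ _ Hp). field. lra. }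
        apply (is_derive_ext_loc (fun s => q s - 2 / (lam + 2 * mu)
                  * (prad s + seth_p0 lam mu - lam * (x s / s) ^ 2))).
        + apply (locally_open_interval r0 r1); [lra |].
          intros t Ht. unfold h. destruct (Hpress t Ht) as [-> _].
          unfold prad_of. match goal with |- ?a = ?b => change (@eq R a b) end.
          field. lra.
        + evar_last; [exact Hd |].
          assert (Heq := shell_equilibrium _ _ _ _ _ Hsh s ltac:(lra)).
          destruct (Hpress s ltac:(lra)) as [Hps Hts].
          rewrite Hmz, Hrho, <- Hx3, Hps, Hts in Heq by lra.
          assert (He := drad_equilibrium s (x s) (w s) ltac:(lra)).
          assert (HD : Derive prad s = drad s (x s) (w s)) by lra.
          rewrite HD. unfold drad.
          match goal with |- ?a = ?b => change (@eq R a b) end. field. lra. }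
    unfold h in Hh.
    assert (q r0 = w r0 ^ 2) by (unfold q; rewrite RInt_point; apply Rplus_0_r).
    lra. }
  assert (Hpressc : forall r, r0 <= r <= r1 ->
    prad r = prad_of (x r / r) (w r ^ 2) /\ ptan r = ptan_of (x r / r) (w r ^ 2)).
  { intros r Hr.
    (* The constitutive law is assumed only inside; continuity extends it to both endpoints. *)
    assert (Hp : prad (clip r0 r1 r) = prad_of (x r / r) (w r ^ 2) /\
                 ptan (clip r0 r1 r) = ptan_of (x r / r) (w r ^ 2)).
    { split.
      - apply (continuous_eq_closed (fun r => prad (clip r0 r1 r))
          (fun r => prad_of (x r / r) (w r ^ 2)) r0 r1); auto.
        + intros s _. apply continuous_on_comp_clip; [lra | assumption].
        + intros s Hs. assert (Hxs := Hxc s Hs). assert (Hws := Hwc s).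
          unfold prad_of. contin; lra.
        + intros s Hs. rewrite clip_id by lra. now apply Hpress.
      - apply (continuous_eq_closed (fun r => ptan (clip r0 r1 r))
          (fun r => ptan_of (x r / r) (w r ^ 2)) r0 r1); auto.
        + intros s _. apply continuous_on_comp_clip; [lra | assumption].
        + intros s Hs. assert (Hxs := Hxc s Hs). assert (Hws := Hwc s).
          unfold ptan_of. contin; lra.
        + intros s Hs. rewrite clip_id by lra. now apply Hpress. }
    now rewrite clip_id in Hp. }
  exists x, q, w. split; [| split; [| split; [| split]]]; try assumption.
  - split.
    + unfold x, z. rewrite RInt_point.
      change (Rpower (Sref ^ 3 + 3 / Kref * 0) (1 / 3) = Sref).
      rewrite Rmult_0_r, Rplus_0_r. now apply Rpower_cube_root.
    + intros r Hr. split; [now apply Hdx | now apply Hdq].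
  - intros r Hr. destruct (Hpressc r Hr) as [H1 H2].
    split; [now apply Hw0 |]. split; [apply Hx |]. split; [now apply Hq |].
    split; [now apply Hrho |]. split; [assumption |]. split; [assumption |].
    rewrite Hx3 by lra. now apply Hmz.
Qed.

Lemma seth_shell_flow r1 rho prad ptan :
  seth_shell lam mu Kref Sref r0 r1 rho prad ptan ->
  1 < Sref / r0 /\
  exists x q w, sflow r1 x q w /\ admissible (Sref / r0) w /\
    (forall r, r0 <= r <= r1 ->
       q r = w r ^ 2 /\
       rho r = Kref * w r * (x r / r) ^ 2 /\
       prad r = prad_of (x r / r) (w r ^ 2) /\
       ptan r = ptan_of (x r / r) (w r ^ 2) /\
       mass r0 rho r = 4 * PI * Kref * (x r ^ 3 - Sref ^ 3) / 3) /\
    q r0 <= (Sref / r0) ^ 2 /\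
    (forall r, r0 < r <= r1 -> 0 < w r < x r / r).
Proof.
  intros Hseth.
  destruct (seth_shell_flow_raw _ _ _ _ Hseth)
    as [x [q [w [Hf [Hwc [Hwclip [Hall Hwpos]]]]]]].
  destruct Hseth as [Hsh _].
  assert (Hr1 := shell_r0_lt_r1 _ _ _ _ _ Hsh).
  set (y0 := Sref / r0).
  assert (Hy0 : 0 < y0) by (apply Rdiv_lt_0_compat; lra).
  assert (Hq : forall r, r0 <= r <= r1 -> q r = w r ^ 2) by (intros; now apply Hall).
  assert (Hp : forall r, r0 <= r <= r1 -> prad r = prad_of (x r / r) (q r)).
  { intros r Hr. rewrite Hq by assumption. now apply Hall. }
  (* Otherwise, by [drad_start], the pressure would fall below its value 0 at [r0] right after
     it. *)
  assert (Hq0 : q r0 <= y0 ^ 2).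
  { apply Rnot_lt_le. intros Hlt.
    assert (Hd := is_derive_prad_of r1 x q w r0 Hf ltac:(lra)).
    apply (is_derive_opp (fun r => prad_of (x r / r) (q r))) in Hd.
    destruct (is_derive_pos_near (fun r => - prad_of (x r / r) (q r)) r0
      (- drad r0 (x r0) (w r0)) Hd) as [d [Hd0 [_ Hright]]].
    - rewrite (proj1 Hf), drad_start. fold y0. rewrite <- Hq by lra.
      replace (- (2 * mu / r0 * (y0 ^ 2 - q r0))) with (2 * mu / r0 * (q r0 - y0 ^ 2))
        by ring.
      apply Rmult_lt_0_compat; [apply Rdiv_lt_0_compat |]; lra.
    - set (t := Rmin ((r0 + r1) / 2) (r0 + d / 2)).
      assert (Ht : r0 < t /\ t <= (r0 + r1) / 2 /\ t <= r0 + d / 2).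
      { unfold t. split; [apply Rmin_glb_lt; lra | split; [apply Rmin_l | apply Rmin_r]]. }
      specialize (Hright t ltac:(lra)).
      rewrite <- !Hp in Hright by lra.
      destruct (shell_boundary _ _ _ _ _ Hsh) as [Hb _].
      destruct (shell_pressures_pos _ _ _ _ _ Hsh t ltac:(lra)) as [Hpt _]. lra. }
  (* Applied on [[r0, r]], since at this stage [w > 0] is not known at [r1]. *)
  assert (Hlt : forall r, r0 < r < r1 -> w r < x r / r).
  { intros r Hr.
    apply (flow_speed_lt_ratio al be ga ka Sref r0 be_pos ga_pos al_split ka_pos hS hr0
      r x q w); try lra; try assumption.
    - apply (flow_restrict al be ga ka Sref r0 r1); [lra | assumption].
    - intros s Hs. apply Hq. lra.
    - intros s Hs. apply Hwpos. lra. }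
  assert (Hle : forall r, r0 <= r <= r1 -> x r / r <= y0).
  { intros r Hr. unfold y0. rewrite <- (proj1 Hf).
    apply (flow_ratio_decr al be ga ka Sref r0 hr0 r1 x q w); try lra; auto.
    intros t Ht. now apply Rlt_le, Hlt. }
  assert (Hgt : 1 < y0).
  { set (t := (r0 + r1) / 2). assert (Ht : r0 < t < r1) by (unfold t; lra).
    apply Rlt_le_trans with (x t / t); [| apply Hle; lra].
    apply (ratio_gt_1 _ (w t)).
    - specialize (Hwpos t Ht). specialize (Hlt t Ht). lra.
    - rewrite <- Hq, <- Hp by lra. now apply Rlt_le, (shell_pressures_pos _ _ _ _ _ Hsh). }
  assert (Hwle : forall r, r0 <= r <= r1 -> w r <= y0).
  { intros r Hr.
    (* The bound holds inside; written as an equality of continuous functions it passes to the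
       endpoints. *)
    assert (Hrm : forall s, r0 <= s <= r1 -> Rmin (w s) y0 = w s).
    { apply continuous_eq_closed; [assumption | | |]; intros s Hs.
      - apply continuous_Rmin; [apply Hwc | apply continuous_const].
      - apply Hwc.
      - apply Rmin_left. specialize (Hlt s Hs). specialize (Hle s ltac:(lra)). lra. }
    rewrite <- (Hrm r Hr). apply Rmin_r. }
  assert (Hadm : admissible y0 w).
  { split; [assumption |]. intros t. rewrite Hwclip.
    assert (Ht := clip_bounds r0 r1 t ltac:(lra)).
    split; [now apply Hall | now apply Hwle]. }
  split; [assumption |].
  exists x, q, w. split; [assumption |]. split; [assumption |].
  split; [intros r Hr; destruct (Hall r Hr) as [_ [_ H]]; exact H |].
  split; [assumption |].
  assert (Hpos := flow_speed_pos al be ga ka Sref r0 be_pos ga_pos al_split hS hr0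
    r1 x q w Hr1 Hf Hadm Hq0 Hq).
  intros r Hr. split; [now apply Hpos |].
  now apply (flow_speed_lt_ratio al be ga ka Sref r0 be_pos ga_pos al_split ka_pos hS hr0
      r1 x q w).
Qed.

(** * Uniqueness of the shell *)

Lemma seth_shell_radius_le r1 rho prad ptan r1' rho' prad' ptan' :
  seth_shell lam mu Kref Sref r0 r1 rho prad ptan ->
  seth_shell lam mu Kref Sref r0 r1' rho' prad' ptan' ->
  r1' <= r1 /\
  forall r, r0 <= r <= r1 -> r <= r1' ->
    rho' r = rho r /\ prad' r = prad r /\ ptan' r = ptan r.
Proof.
  intros Hs Hs'.
  destruct (seth_shell_flow _ _ _ _ Hs) as [_ [x [q [w [Hf [Hw [Hall [Hq0 _]]]]]]]].
  destruct (seth_shell_flow _ _ _ _ Hs') as [_ [x' [q' [w' [Hf' [Hw' [Hall' [Hq0' _]]]]]]]].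
  destruct Hs as [Hsh _]. destruct Hs' as [Hsh' _].
  assert (Hr1 := shell_r0_lt_r1 _ _ _ _ _ Hsh).
  assert (Hr1' := shell_r0_lt_r1 _ _ _ _ _ Hsh').
  destruct (shell_boundary _ _ _ _ _ Hsh) as [Hb0 Hb1].
  destruct (shell_boundary _ _ _ _ _ Hsh') as [Hb0' _].
  assert (Heq : forall r, r0 <= r <= r1 -> r <= r1' ->
    rho' r = rho r /\ prad' r = prad r /\ ptan' r = ptan r).
  (* Vanishing radial pressure at [r0] determines the initial speed squared. *)
  { assert (Hqq : q' r0 = q r0).
    { destruct (Hall r0 ltac:(lra)) as [-> [_ [H _]]].
      destruct (Hall' r0 ltac:(lra)) as [-> [_ [H' _]]].
      rewrite Hb0, (proj1 Hf) in H. rewrite Hb0', (proj1 Hf') in H'.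
      unfold prad_of in *. nra. }
    intros r Hr Hr'.
    assert (Hm1 := Rmin_l r1 r1'). assert (Hm2 := Rmin_r r1 r1').
    destruct (flow_unique al be ga ka Sref r0 be_pos ga_pos al_split hS hr0
      (Rmin r1 r1') x q w x' q' w') with (r := r) as [Hx Hww]; try assumption.
    - apply Rmin_glb_lt; lra.
    - now apply (flow_restrict al be ga ka Sref r0 r1).
    - now apply (flow_restrict al be ga ka Sref r0 r1').
    - intros s Hs. apply Hall. lra.
    - intros s Hs. apply Hall'. lra.
    - split; [lra | apply Rmin_glb; lra].
    - destruct (Hall r ltac:(lra)) as [_ [-> [-> [-> _]]]].
      destruct (Hall' r ltac:(lra)) as [_ [-> [-> [-> _]]]].
      rewrite Hx, Hww. auto. }
  split; [| assumption].
  (* If [r1 < r1'], then [prad' r1 = prad r1 = 0] at an interior point of the second shell. *)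
  apply Rnot_lt_le. intros Hlt.
  destruct (Heq r1) as [_ [H _]]; [lra | lra |].
  destruct (shell_pressures_pos _ _ _ _ _ Hsh' r1) as [Hp _]; [lra |]. lra.
Qed.

Lemma seth_shell_unique r1 rho prad ptan r1' rho' prad' ptan' :
  seth_shell lam mu Kref Sref r0 r1 rho prad ptan ->
  seth_shell lam mu Kref Sref r0 r1' rho' prad' ptan' ->
  r1' = r1 /\
  forall r, 0 <= r -> rho' r = rho r /\ prad' r = prad r /\ ptan' r = ptan r.
Proof.
  intros Hs Hs'.
  destruct (seth_shell_radius_le _ _ _ _ _ _ _ _ Hs Hs') as [Hle Heq].
  destruct (seth_shell_radius_le _ _ _ _ _ _ _ _ Hs' Hs) as [Hge _].
  assert (H : r1' = r1) by lra. split; [assumption |]. subst r1'.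
  intros r Hr.
  destruct (Rle_dec r0 r) as [H0|H0]; [destruct (Rle_dec r r1) as [H1|H1] |].
  - apply Heq; lra.
  - destruct (shell_vacuum _ _ _ _ _ (proj1 Hs) r Hr) as [-> [-> ->]]; [lra |].
    apply (shell_vacuum _ _ _ _ _ (proj1 Hs') r Hr). lra.
  - destruct (shell_vacuum _ _ _ _ _ (proj1 Hs) r Hr) as [-> [-> ->]]; [lra |].
    apply (shell_vacuum _ _ _ _ _ (proj1 Hs') r Hr). lra.
Qed.

End Seth.

Theorem theorem3 (lam mu Kref Sref r0 : R)
  (hlam : 0 < lam) (hmu : 0 < mu) (hK : 0 < Kref) (hS : 0 < Sref)
  (hr0 : 0 < r0) :
  let rmin := sqrt (2 * lam / (3 * lam + 2 * mu)) * Sref in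
  ((exists (r1 : R) (rho prad ptan : R -> R),
      seth_shell lam mu Kref Sref r0 r1 rho prad ptan /\
      (forall (r1' : R) (rho' prad' ptan' : R -> R),
         seth_shell lam mu Kref Sref r0 r1' rho' prad' ptan' ->
         r1' = r1 /\
         (forall r : R, 0 <= r ->
            rho' r = rho r /\ prad' r = prad r /\ ptan' r = ptan r)))
   <-> rmin <= r0 < Sref) /\
  ((exists (r1 : R) (rho prad ptan : R -> R),
      seth_shell lam mu Kref Sref r0 r1 rho prad ptan)
   -> rmin <= r0 < Sref) /\
  (forall (r1 : R) (rho prad ptan : R -> R),
     seth_shell lam mu Kref Sref r0 r1 rho prad ptan ->
     let M := mass r0 rho r1 in
     let Rref := Rpower (Sref ^ 3 + 3 * M / (4 * PI * Kref)) (1 / 3) in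
     (rho r0 = 0 <-> r0 = rmin) /\
     0 < rho r1 /\
     sqrt (2 * lam / (3 * lam + 2 * mu)) * Rref < r1 < Rref).
Proof.
  intros rmin.
  set (k := sqrt (2 * lam / (3 * lam + 2 * mu))) in *.
  assert (Hk0 : 0 < 2 * lam / (3 * lam + 2 * mu)) by (apply Rdiv_lt_0_compat; lra).
  assert (Hk : 0 < k) by now apply sqrt_lt_R0.
  (* Thus at [w = 0] the radial pressure is [seth_p0 lam mu * ((k * y) ^ 2 - 1)], and the bounds on
     radii become comparisons of [k * y] with 1. *)
  assert (Hp0 : lam = k ^ 2 * seth_p0 lam mu).
  { unfold k. rewrite pow2_sqrt by lra. unfold seth_p0. field. lra. }
  assert (Hp0pos : 0 < seth_p0 lam mu) by (unfold seth_p0; lra).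
  assert (Hlam : forall y, lam * y ^ 2 = seth_p0 lam mu * (k * y) ^ 2)
    by (intros y; rewrite Hp0 at 1; ring).
  assert (Hrmin : rmin = k * (Sref / r0) * r0) by (unfold rmin; field; lra).
  assert (Hy0 : 0 < k * (Sref / r0))
    by (apply Rmult_lt_0_compat; [| apply Rdiv_lt_0_compat]; lra).
  assert (Hnec : forall r1 rho prad ptan,
     seth_shell lam mu Kref Sref r0 r1 rho prad ptan -> rmin <= r0 < Sref).
  { intros r1 rho prad ptan Hs.
    destruct (seth_shell_flow lam mu Kref Sref r0 hlam hmu hK hS hr0 _ _ _ _ Hs)
      as [Hy [x [q [w [Hf [_ [Hall _]]]]]]].
    destruct Hs as [Hsh _].
    assert (Hr1 := shell_r0_lt_r1 _ _ _ _ _ Hsh).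
    destruct (shell_boundary _ _ _ _ _ Hsh) as [Hb _].
    split.
    - destruct (Hall r0 ltac:(lra)) as [_ [_ [H _]]].
      rewrite Hb, (proj1 Hf) in H. unfold prad_of in H. rewrite Hlam in H.
      assert (Hw2 := pow2_ge_0 (w r0)).
      assert ((k * (Sref / r0)) ^ 2 <= 1) by nra.
      rewrite Hrmin. nra.
    - apply Rlt_div_r in Hy; lra. }
  split; [split | split].
  - intros [r1 [rho [prad [ptan [Hs _]]]]]. exact (Hnec _ _ _ _ Hs).
  - intros [Hmin Hlt].
    destruct (seth_shell_exists lam mu Kref Sref r0 hlam hmu hK hS hr0)
      as [r1 [rho [prad [ptan Hs]]]].
    + apply Rlt_div_r; lra.
    + rewrite Hlam. rewrite Hrmin in Hmin.
      assert (k * (Sref / r0) <= 1) by nra.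
      assert ((k * (Sref / r0)) ^ 2 <= 1) by nra. nra.
    + exists r1, rho, prad, ptan. split; [assumption |].
      intros r1' rho' prad' ptan' Hs'.
      now apply (seth_shell_unique lam mu Kref Sref r0 hlam hmu hK hS hr0).
  - intros [r1 [rho [prad [ptan Hs]]]]. exact (Hnec _ _ _ _ Hs).
  - intros r1 rho prad ptan Hs M Rref.
    destruct (seth_shell_flow lam mu Kref Sref r0 hlam hmu hK hS hr0 _ _ _ _ Hs)
      as [Hy [x [q [w [Hf [_ [Hall [_ Hwy]]]]]]]].
    destruct Hs as [Hsh _].
    assert (Hr1 := shell_r0_lt_r1 _ _ _ _ _ Hsh).
    destruct (shell_boundary _ _ _ _ _ Hsh) as [Hb0 Hb1].
    specialize (Hwy r1 ltac:(lra)).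
    assert (Hpi := PI_RGT_0).
    assert (Hx1 : 0 < x r1).
    { replace (x r1) with (x r1 / r1 * r1) by (field; lra).
      apply Rmult_lt_0_compat; lra. }
    destruct (Hall r1 ltac:(lra)) as [_ [Hrho1 [Hp1 [_ Hm1]]]].
    assert (HRref : Rref = x r1).
    { unfold Rref, M. rewrite Hm1.
      replace (Sref ^ 3 + 3 * (4 * PI * Kref * (x r1 ^ 3 - Sref ^ 3) / 3) / (4 * PI * Kref))
        with (x r1 ^ 3) by (field; lra).
      now apply Rpower_cube_root. }
    split; [| split].
    + destruct (Hall r0 ltac:(lra)) as [_ [-> [H _]]].
      rewrite Hb0 in H. rewrite (proj1 Hf) in *. unfold prad_of in H. rewrite Hlam in H.
      assert (Hs2 : 0 < Kref * (Sref / r0) ^ 2)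
        by (apply Rmult_lt_0_compat; [| apply pow_lt]; lra).
      rewrite Hrmin.
      split; intros He.
      * assert (w r0 = 0) by nra.
        assert ((k * (Sref / r0)) ^ 2 = 1) by nra.
        assert (k * (Sref / r0) = 1) by nra. nra.
      * assert (Hone : k * (Sref / r0) = 1) by (apply (Rmult_eq_reg_r r0); lra).
        rewrite Hone in H.
        assert (Hw : (lam + 2 * mu) / 2 * w r0 ^ 2 = 0) by lra.
        apply Rmult_integral in Hw. destruct Hw as [Hw | Hw]; [lra |].
        assert (w r0 = 0) by nra. nra.
    + rewrite Hrho1. apply Rmult_lt_0_compat; [nra | apply pow_lt; lra].
    + rewrite HRref. rewrite Hb1 in Hp1. split.
      * unfold prad_of in Hp1. rewrite Hlam in Hp1.
        (* The radial pressure vanishes at [r1] while [w r1 > 0] contributes a positive term. *)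
        assert (Hlt : (k * (x r1 / r1)) ^ 2 < 1).
        { assert (0 < w r1 ^ 2) by (apply pow_lt; lra). nra. }
        assert (k * (x r1 / r1) < 1) by nra.
        replace (k * x r1) with (k * (x r1 / r1) * r1) by (field; lra). nra.
      * assert (Hgt : 1 < x r1 / r1)
          by (apply (ratio_gt_1 lam mu hlam hmu _ (w r1)); lra).
        replace (x r1) with (x r1 / r1 * r1) by (field; lra). nra.
Qed.
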